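(* Let $(M,g)$ be a Riemannian $n$-manifold, let $x\in M$ be fixed and let $(E_\alpha)$ be an orthonormal basis of $2$-forms diagonalizing the Riemann curvature operator at $x$. Assume that for each $\alpha$ the rank of $E_\alpha$ is $\leq 2r$, for some fixed integer $r\ge 1$. (a) Let $\omega$ be a $(p,0)$ double form at $x$, $\omega\neq 0$, with $p\geq 1$. If the sum of the lowest $\lfloor \frac{p(n-p)}{\min\{p,r\}}\rfloor$ eigenvalues (counted with multiplicity) of the Riemann curvature tensor at $x$ is positive (resp. nonnegative), then $\langle \mathrm{Ric}_L(\omega),\omega\rangle>0$ (resp. $\geq 0$). (b) Let $\omega$ be a symmetric and trace free $(p,p)$ double form at $x$, $\omega\neq 0$, that satisfies the first Bianchi identity, with $p\geq 1$. If the sum of the lowest $\lfloor \frac{p(n-p+1)}{2\min\{p,r\}}\rfloor$ eigenvalues (counted with multiplicity) of the Riemann curvature tensor at $x$ is positive (resp. nonnegative), then $\langle \mathrm{Ric}_L(\omega),\omega\rangle>0$ (resp. $\geq 0$).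
   Context: A $(p,q)$ double form at $x$ is an element of $\Lambda^pT_x^*M\otimes\Lambda^qT_x^*M$, with the inner product making $\{e^I\otimes e^J\}$ ($I,J$ increasing multi-indices) orthonormal for orthonormal $(e_i)$ with dual basis $(e^i)$. The transpose is $(\theta_1\otimes\theta_2)^t=\theta_2\otimes\theta_1$; symmetric means $\omega^t=\omega$. The exterior product is $(\theta_1\otimes\theta_2).(\theta_3\otimes\theta_4)=(\theta_1\wedge\theta_3)\otimes(\theta_2\wedge\theta_4)$; the contraction $\mathbf{c}$ is the adjoint of left multiplication by $g$ (a $(1,1)$ double form); trace free means $\mathbf{c}\omega=0$. The first Bianchi sum is $\mathfrak{S}(\omega_1\otimes\omega_2)=\sum_i(e^i\wedge\omega_1)\otimes\iota_{e_i}\omega_2$; the first Bianchi identity is $\mathfrak{S}\omega=0$. The curvature operator at $x$ is the self-adjoint operator on $\Lambda^2T_x^*M$ associated with the Riemann curvature tensor, normalized so that its eigenvalues all equal $1$ on the unit round sphere. The eigenvalue of $E_\alpha$ is denoted $\lambda_\alpha$. The rank of a 2-form is the minimum number of covectors in terms of which it can be expressed. For a 2-form $E$, let $A_E$ be the derivation of $\Lambda T_x^*M$ given by $A_E\theta=\sum_k\iota_{e_k}E\wedge\iota_{e_k}\theta$ ($(e_k)$ orthonormal), and let $(\rho(E))_d(\theta_1\otimes\theta_2)=A_E\theta_1\otimes\theta_2+\theta_1\otimes A_E\theta_2$. Then $$\mathrm{Ric}_L(\omega)=-\sum_\alpha\lambda_\alpha\,(\rho(E_\alpha))_d\circ(\rho(E_\alpha))_d(\omega).$$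 *)

(* Defs.v *)
From HB Require Import structures.
From mathcomp Require Import all_boot all_order all_algebra.
From mathcomp Require Import reals.
Set Implicit Arguments.
Unset Strict Implicit.
Unset Printing Implicit Defensive.
Import Order.TTheory GRing.Theory Num.Theory.
Local Open Scope ring_scope.

(* A Riemannian manifold (M, g) enters pointwise: V is the tangent space at x,
   g the metric on it and Rm the Riemann tensor at x. *)
Section TangentSpace.
Variables (R : realType) (V : vectType R).

Definition inner_product (g : V -> V -> R) : Prop :=
  [/\ forall y, scalar (g^~ y),
      forall x y, g x y = g y x
    & forall x, x != 0 -> 0 < g x x].

Definition orthonormal_frame (g : V -> V -> R) n (e : 'I_n -> V) : Prop :=
  forall i j, g (e i) (e j) = (i == j)%:R.

(* A (0,4) tensor with the algebraic symmetries of the Riemann tensor. *)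
Definition curvature_tensor (Rm : V -> V -> V -> V -> R) : Prop :=
  [/\ [/\ forall y z t, scalar (fun x => Rm x y z t),
          forall x z t, scalar (fun y => Rm x y z t),
          forall x y t, scalar (fun z => Rm x y z t)
        & forall x y z, scalar (fun t => Rm x y z t)],
      forall x y z t, Rm y x z t = - Rm x y z t,
      forall x y z t, Rm x y t z = - Rm x y z t,
      forall x y z t, Rm z t x y = Rm x y z t
    & forall x y z t, Rm x y z t + Rm y z x t + Rm z x y t = 0].

End TangentSpace.

(* Relative to an orthonormal frame (e_1, .., e_n), an element
   theta = \sum_I theta_I e^I of the exterior algebra of the dual is the
   family of its coefficients; a set I of indices stands for the increasing
   multi-index enumerating it.  Likewise a double form is
   \sum_(I, J) omega_(I, J) (e^I \otimes e^J).  R^o is R as a module over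
   itself; it is what makes the function spaces below R-modules. *)
Notation extform R n := {ffun {set 'I_n} -> R^o}.
Notation dblform R n := {ffun {set 'I_n} * {set 'I_n} -> R^o}.

(* The inner products making (e^I), resp. (e^I \otimes e^J), orthonormal. *)
Definition dot (R : realType) (X : finType) (u v : {ffun X -> R^o}) : R :=
  \sum_x u x * v x.

Section Forms.
Variables (R : realType) (n : nat).
Implicit Types (I J K : {set 'I_n}) (i j k : 'I_n) (p q : nat).
Implicit Types (theta eta E : extform R n) (omega : dblform R n).

Definition ext_basis I : extform R n := [ffun K => (K == I)%:R].

Definition is_form p theta : Prop := forall I, theta I != 0 -> #|I| = p.

(* Sorting the concatenation of I and J takes [inversions I J]
   transpositions of neighbours. *)
Definition inversions I J : nat :=
  #|[set ij : 'I_n * 'I_n |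
      [&& ij.1 \in I, ij.2 \in J & (ij.2 < ij.1)%N]]|.

Definition wedge theta eta : extform R n :=
  [ffun K : {set 'I_n} => \sum_(I : {set 'I_n} | I \subset K)
     (-1) ^+ inversions I (K :\: I) * theta I * eta (K :\: I)].

(* Contraction with e_k in the first slot:
   iota_(e_k) (e^k /\ e^I) = e^I when k \notin I. *)
Definition iota_form k theta : extform R n :=
  [ffun I : {set 'I_n} =>
     if k \in I then 0 else (-1) ^+ inversions [set k] I * theta (k |: I)].

(* E is a linear combination of wedge products of m covectors. *)
Definition expressible_with E (m : nat) : Prop :=
  exists (theta : 'I_m -> extform R n) (a : 'M[R]_m),
    (forall s, is_form 1 (theta s)) /\
    E = \sum_(s < m) \sum_(t < m | (s < t)%N)
          a s t *: wedge (theta s) (theta t).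

Definition is_rank E (m : nat) : Prop :=
  expressible_with E m /\
  forall m', expressible_with E m' -> (m <= m')%N.

Definition tens theta eta : dblform R n :=
  [ffun IJ : {set 'I_n} * {set 'I_n} => theta IJ.1 * eta IJ.2].

Definition is_dblform p q omega : Prop :=
  forall I J, omega (I, J) != 0 -> #|I| = p /\ #|J| = q.

(* Value at omega of the linear map sending theta \otimes eta to
   F theta eta, for a bilinear F. *)
Definition tens_ext (W : lmodType R) (F : extform R n -> extform R n -> W)
    omega : W :=
  \sum_(I : {set 'I_n}) \sum_(J : {set 'I_n})
    omega (I, J) *: F (ext_basis I) (ext_basis J).

Definition transpose : dblform R n -> dblform R n :=
  tens_ext (fun theta1 theta2 => tens theta2 theta1).

Definition dbl_symmetric omega : Prop := transpose omega = omega.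

Definition dbl_mul omega1 omega2 : dblform R n :=
  tens_ext (fun theta1 theta2 =>
    tens_ext (fun theta3 theta4 =>
      tens (wedge theta1 theta3) (wedge theta2 theta4)) omega2) omega1.

Definition metric_form : dblform R n :=
  \sum_i tens (ext_basis [set i]) (ext_basis [set i]).

(* The adjoint of the left multiplication by the metric
   (see [dot_contraction]), by its coefficients in the orthonormal basis. *)
Definition contraction omega : dblform R n :=
  [ffun IJ : {set 'I_n} * {set 'I_n} =>
     dot omega
       (dbl_mul metric_form (tens (ext_basis IJ.1) (ext_basis IJ.2)))].

Definition trace_free omega : Prop := contraction omega = 0.

Definition bianchi_sum : dblform R n -> dblform R n :=
  tens_ext (fun theta1 theta2 =>
    \sum_i tens (wedge (ext_basis [set i]) theta1) (iota_form i theta2)).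

Definition first_bianchi omega : Prop := bianchi_sum omega = 0.

Definition derivation E theta : extform R n :=
  \sum_k wedge (iota_form k E) (iota_form k theta).

Definition dbl_rho E : dblform R n -> dblform R n :=
  tens_ext (fun theta1 theta2 =>
    tens (derivation E theta1) theta2 + tens theta1 (derivation E theta2)).

Definition Ric_L (A : finType) (E : A -> extform R n) (lambda : A -> R)
    omega : dblform R n :=
  - \sum_a lambda a *: dbl_rho (E a) (dbl_rho (E a) omega).

Definition orthonormal_basis2 (A : finType) (E : A -> extform R n) : Prop :=
  [/\ forall a, is_form 2 (E a),
      forall a b, dot (E a) (E b) = (a == b)%:R
    & forall theta, is_form 2 theta ->
        exists c : A -> R, theta = \sum_a c a *: E a].

(* Rm x y x y is the sectional curvature of orthonormal x, y, so that on the
   unit round sphere, where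
   Rm x y z t = g x z * g y t - g x t * g y z,
   this operator is the identity on 2-forms
   (see [curvature_operator_sphere]). *)
Definition curvature_operator (V : Type) (Rm : V -> V -> V -> V -> R)
    (e : 'I_n -> V) E : extform R n :=
  \sum_(i < n) \sum_(j < n | (i < j)%N) \sum_(k < n) \sum_(l < n | (k < l)%N)
    (Rm (e i) (e j) (e k) (e l) * E [set i; j]) *: ext_basis [set k; l].

End Forms.

(* [codom lambda] lists every value as often as it is taken. *)
Definition sum_lowest (R : realType) (A : finType) (lambda : A -> R)
    (m : nat) : R :=
  \sum_(x <- take m (sort <=%R (codom lambda))) x.

(* [contraction] is the adjoint of the multiplication by the metric, and
   [curvature_operator] is normalized by the unit round sphere. *)
Section Checks.
Variables (R : realType) (n : nat).
Implicit Types (omega eta : dblform R n).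

Lemma tens_basisE (I J : {set 'I_n}) (K L : {set 'I_n}) :
  tens (ext_basis R I) (ext_basis R J) (K, L) = (K == I)%:R * (L == J)%:R.
Proof. by rewrite !ffunE. Qed.

Lemma tens_ext_basis (W : lmodType R)
    (F : extform R n -> extform R n -> W) (I J : {set 'I_n}) :
  tens_ext F (tens (ext_basis R I) (ext_basis R J))
  = F (ext_basis R I) (ext_basis R J).
Proof.
rewrite /tens_ext (bigD1 I) //= (bigD1 J) //= tens_basisE !eqxx mulr1 scale1r.
rewrite !big1 ?addr0 //.
  by move=> K /negbTE nK; rewrite big1 // => L _;
     rewrite tens_basisE nK mul0r scale0r.
by move=> L /negbTE nL; rewrite tens_basisE nL mulr0 scale0r.
Qed.

Lemma dot_contraction omega eta :
  dot (contraction omega) eta = dot omega (dbl_mul (metric_form R n) eta).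
Proof.
have mulE : dbl_mul (metric_form R n) eta
   = \sum_IJ eta IJ *: dbl_mul (metric_form R n)
       (tens (ext_basis R IJ.1) (ext_basis R IJ.2)).
  rewrite /dbl_mul {1}/tens_ext.
  under [RHS]eq_bigr do rewrite {1}/tens_ext scaler_sumr.
  rewrite [RHS]exchange_big; apply: eq_bigr => I _ /=.
  under [RHS]eq_bigr do rewrite scaler_sumr.
  rewrite [RHS]exchange_big; apply: eq_bigr => J _ /=.
  rewrite [in LHS]/tens_ext pair_bigA scaler_sumr; apply: eq_bigr => IJ _ /=.
  have /= -> := tens_ext_basis (fun theta3 theta4 =>
    tens (wedge (ext_basis R I) theta3) (wedge (ext_basis R J) theta4))
    IJ.1 IJ.2.
  by rewrite !scalerA mulrC; case: IJ.
rewrite mulE /dot.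
under [RHS]eq_bigr => x _ do rewrite sum_ffunE mulr_sumr.
rewrite [RHS]exchange_big; apply: eq_bigr => IJ _ /=.
rewrite ffunE /dot mulr_suml; apply: eq_bigr => x _.
by rewrite [in RHS]ffunE -mulrA; congr (_ * _); rewrite mulrC.
Qed.

Lemma curvature_operator_sphere (V : vectType R) (g : V -> V -> R)
    (e : 'I_n -> V) (E : extform R n) :
  orthonormal_frame g e -> is_form 2 E ->
  curvature_operator (fun x y z t => g x z * g y t - g x t * g y z) e E = E.
Proof.
move=> He HE.
have sum1 (i : 'I_n) (W : lmodType R) (F : 'I_n -> W) (P : pred 'I_n) :
    \sum_(k | P k) (i == k)%:R *: F k = if P i then F i else 0.
  case: ifPn => Pi.
    rewrite (bigD1 i) //= eqxx scale1r big1 ?addr0 // => k /andP[_ nk].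
    by rewrite eq_sym (negbTE nk) scale0r.
  rewrite big1 // => k Pk; case: eqP => [ik|]; last by rewrite scale0r.
  by rewrite ik Pk in Pi.
have -> : curvature_operator (fun x y z t => g x z * g y t - g x t * g y z) e E
    = \sum_(i < n) \sum_(j < n | (i < j)%N) E [set i; j] *: ext_basis R [set i; j].
  apply: eq_bigr => i _; apply: eq_bigr => j ij.
  rewrite (eq_bigr (fun k : 'I_n => (i == k)%:R *: \sum_(l < n | (k < l)%N)
       (j == l)%:R *: (E [set i; j] *: ext_basis R [set k; l]))).
    by rewrite sum1 sum1 ij.
  move=> k _; rewrite scaler_sumr; apply: eq_bigr => l kl; rewrite !He.
  rewrite !scalerA; congr (_ *: _).
  suff -> : (i == l)%:R * (j == k)%:R = 0 :> R by rewrite subr0.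
  case: eqP => [il|]; last by rewrite mul0r.
  case: eqP => [jk|]; last by rewrite mulr0.
  by move: kl; rewrite -il -jk ltnNge (ltnW ij).
apply/ffunP => K; rewrite sum_ffunE.
have [nz|z] := boolP (E K != 0); last first.
  rewrite (eqP (negPn z)) big1 // => i _; rewrite sum_ffunE big1 // => j ij.
  rewrite !ffunE; have [<-|] := eqVneq K; last by rewrite scaler0.
  by rewrite (eqP (negPn z)) scale0r.
have /eqP/cards2P [a [b [nab Kab]]] := HE _ nz.
wlog lab : a b nab Kab / (a < b)%N.
  move=> H; have [|ab] := ltnP a b; first exact: H.
  apply: (H b a); [by rewrite eq_sym | by rewrite setUC |].
  by rewrite ltn_neqAle ab andbT eq_sym.
have set2E (i j : 'I_n) : (i < j)%N -> (K == [set i; j]) = (i == a) && (j == b).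
  move=> ij; apply/eqP/andP => [|[/eqP-> /eqP->]//].
  rewrite Kab => /setP eqs.
  have := eqs a; have := eqs b; have := eqs i; have := eqs j.
  rewrite !inE !eqxx /= !orbT.
  move=> /orP[] /eqP ja /orP[] /eqP ia; rewrite ?ia ?ja ?eqxx //;
    rewrite ?ia ?ja in ij *; move: ij; rewrite ?ltnn // ltnNge ltnW //.
rewrite (bigD1 a) //= [X in _ + X]big1 ?addr0.
  rewrite sum_ffunE (bigD1 b) //= [X in _ + X]big1 ?addr0.
    by rewrite !ffunE -Kab eqxx /= /GRing.scale /= mulr1.
  move=> j /andP[aj nj]; rewrite !ffunE set2E // (negbTE nj) andbF.
  by rewrite scaler0.
move=> i ni; rewrite sum_ffunE big1 // => j ij.
by rewrite !ffunE set2E // (negbTE ni) scaler0.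
Qed.

End Checks.

(* Main.v *)
Require Import Defs.
From HB Require Import structures.
From mathcomp Require Import all_boot all_order all_algebra.
From mathcomp Require Import reals ring lra zify complex.
Set Implicit Arguments.
Unset Strict Implicit.
Unset Printing Implicit Defensive.
Import Order.TTheory GRing.Theory Num.Theory.
Local Open Scope ring_scope.

(** The quadratic form of the curvature term is a weighted sum of the
    eigenvalues.  Every rho(E_a) is skew-adjoint, so
      <Ric_L omega, omega> = sum_a lambda_a x_a
    with x_a = |rho(E_a) omega|^2 >= 0 ([dot_Ric_L]).  If no single weight x_a
    exceeds a fraction 1/m of the total S = sum_a x_a, such a sum is smallest
    when the m lowest eigenvalues each receive the weight S/m; this is
    [sum_lowest_le].  What remains is the value of S and an upper bound on x_a.

    Both come from the anticommutation relations between the contractions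
    a_k = iota_(e_k) and the exterior multiplications c_k = e^k /\ _ : they give
    A_E = sum_(k,l) B_kl c_l a_k, where B is the skew matrix of E.

    The total S does not depend on the orthonormal basis (E_a)
    ([casimir_sum]), and normal ordering yields p(n - p) |omega|^2 on p-forms
    ([casimir_same]).  On a double form omega the two tensor factors contribute
    p(n - p) |omega|^2 each, and the mixed term is a combination of
    |c omega|^2, |b omega|^2 and p |omega|^2, with c the contraction and b the
    first Bianchi sum ([casimir_cross]); so for trace free omega with the first
    Bianchi identity the total is 2p(n - p + 1) |omega|^2 ([casimir_bianchi]).

    For the upper bound, a skew matrix of rank at most 2r is an orthogonal sum
    of at most r rotations: E = sum_s d_s f_s /\ g_s with all the f_s, g_s
    orthonormal ([skew_normal_form]).  Cauchy-Schwarz gives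
      |A_E omega|^2 <= (sum_s d_s^2) (sum_s |A_(f_s /\ g_s) omega|^2),
    where the first factor is |E|^2 = 1.  Each term of the second factor is at
    most |omega|^2, whence the bound r; it is also at most
    |iota_(f_s) omega|^2 + |iota_(g_s) omega|^2, and by Bessel these add up to
    at most p |omega|^2 ([one_body_bound]).  So x_a <= min(p, r) |omega|^2 on
    p-forms, and x_a <= 4 min(p, r) |omega|^2 on double forms, where rho(E_a)
    is a sum of two such operators. *)

(** * Orthogonal normal form of skew matrices *)

Section SkewNormalForm.
Variables (R : realType) (n : nat).
Implicit Types (B : 'M[R]_n) (x y : 'rV[R]_n).

Lemma mul_tr_gt0 x : x != 0 -> 0 < (x *m x^T) 0 0.
Proof.
move=> /rV0Pn[i xi]; rewrite mxE (bigD1 i) //= mxE -expr2.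
rewrite ltr_wpDr ?exprn_even_gt0 //.
by apply: sumr_ge0 => j _; rewrite mxE -expr2 sqr_ge0.
Qed.

Lemma mul_tr_ge0 x : 0 <= (x *m x^T) 0 0.
Proof.
by have [->|/mul_tr_gt0/ltW//] := eqVneq x 0; rewrite mul0mx mxE.
Qed.

(** A real skew matrix is normal, hence unitarily diagonalizable over the
    complex numbers, and it has a nonzero eigenvalue a + ib unless it is zero;
    x and y are the real and imaginary parts of an eigenvector. *)
Lemma complex_eigenrow B : B^T = - B -> B != 0 ->
  exists (a b : R) x y, [/\ (a != 0) || (b != 0), (x != 0) || (y != 0),
    x *m B = a *: x - b *: y & y *m B = b *: x + a *: y].
Proof.
move=> skewB nzB; pose BC : 'M[R[i]]_n := map_mx (real_complex R) B.
have normBC : BC \is normalmx.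
  apply/normalmxP; suff -> : map_mx (@Num.conj _) (BC^T) = - BC by rewrite mulmxN mulNmx.
  apply/matrixP => i j; rewrite !mxE.
  have /matrixP/(_ i j) := skewB; rewrite !mxE => ->.
  by apply/eqP; rewrite eq_complex /= oppr0 !eqxx.
have [i di] : exists i, spectral_diag BC 0 i != 0.
  apply/rV0Pn; apply: contraNneq nzB => d0.
  have := orthomx_spectralP normBC; rewrite d0 (raddf0 (@diag_mx _ n)).
  rewrite mulmx0 mul0mx => /matrixP BC0.
  by apply/eqP/matrixP => i j; have := BC0 i j; rewrite !mxE; case.
pose P := spectralmx BC; pose z := row i P.
have zB : z *m BC = spectral_diag BC 0 i *: z.
  rewrite -row_mul [X in P *m X](orthomx_spectralP normBC) !mulmxA.
  rewrite mulmxV ?spectral_unit // mul1mx.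
  by rewrite row_mul row_diag_mx -scalemxAl -rowE.
have nzz : z != 0.
  apply: contraTneq (spectral_unit BC) => z0.
  rewrite -row_free_unit; apply/row_freePn; exists i.
  by rewrite -/P -/z z0 sub0mx.
move: zB di; case: (spectral_diag BC 0 i) => a b zB di.
exists a, b, (map_mx (@complex.Re R) z), (map_mx (@complex.Im R) z); split.
- by move: di; rewrite eq_complex negb_and.
- apply: contraNT nzz; rewrite negb_or !negbK => /andP[/eqP/matrixP z0 /eqP/matrixP z1].
  apply/eqP/matrixP => j k; have := z0 j k; have := z1 j k.
  by rewrite !mxE; case: (P i k) => ? ? /= -> ->.
- apply/matrixP => j k; have /matrixP/(_ j k)/(congr1 (@complex.Re R)) := zB.
  rewrite !mxE raddf_sum => eqz; transitivity (complex.Re ((a +i* b)%C * P i k)).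
    rewrite -eqz; apply: eq_bigr => l _; rewrite !mxE.
    by case: (P i l) => u v /=; rewrite mulr0 subr0.
  by case: (P i k).
- apply/matrixP => j k; have /matrixP/(_ j k)/(congr1 (@complex.Im R)) := zB.
  rewrite !mxE raddf_sum => eqz; transitivity (complex.Im ((a +i* b)%C * P i k)).
    rewrite -eqz; apply: eq_bigr => l _; rewrite !mxE.
    by case: (P i l) => u v /=; rewrite mulr0 add0r.
  by case: (P i k) => u v /=; rewrite addrC.
Qed.

Lemma skew_form_tr B x y : B^T = - B ->
  (x *m B *m y^T) 0 0 = - (y *m B *m x^T) 0 0.
Proof.
move=> skewB; have -> : x *m B *m y^T = - (y *m B *m x^T)^T.
  by rewrite !trmx_mul trmxK skewB mulNmx mulmxN opprK mulmxA.
by rewrite !mxE.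
Qed.

(** Skewness of [B] evaluated on the real and imaginary parts of an
    eigenvector shows that the eigenvalue is imaginary and that the two parts
    are orthogonal of the same length; hence they span a plane on which [B] is
    a rotation by a right angle times a factor. *)
Lemma skew_plane B : B^T = - B -> B != 0 ->
  exists (b : R) x y, [/\ b != 0, x *m x^T = 1%:M, y *m y^T = 1%:M,
    x *m y^T = 0 & x *m B = b *: y /\ y *m B = - b *: x].
Proof.
move=> skewB nzB; have [a [b [x [y [nzab nzxy xB yB]]]]] := complex_eigenrow skewB nzB.
have xy_yx : (x *m y^T) 0 0 = (y *m x^T) 0 0.
  by rewrite -[in RHS](trmxK y) -trmx_mul [in RHS]mxE.
have nx := mul_tr_ge0 x; have ny := mul_tr_ge0 y.
have nxy : 0 < (x *m x^T) 0 0 + (y *m y^T) 0 0.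
  by case/orP: nzxy => /mul_tr_gt0 ?; lra.
have := skew_form_tr x x skewB; have := skew_form_tr y y skewB.
have := skew_form_tr x y skewB.
rewrite xB yB !(mulmxDl, mulmxBl, mulNmx) -!scalemxAl.
have ent (u v : R) (M N : 'M[R]_1) :
    ((u *: M - v *: N) 0 0 = u * M 0 0 - v * N 0 0) *
    ((u *: M + v *: N) 0 0 = u * M 0 0 + v * N 0 0) by rewrite !mxE.
rewrite !ent xy_yx.
set X := (x *m x^T) 0 0 in nx nxy *; set Y := (y *m y^T) 0 0 in ny nxy *.
set Z := (y *m x^T) 0 0 => e1 e2 e3.
have a0 : a = 0.
  apply: (mulIf (lt0r_neq0 nxy)); rewrite mul0r; lra.
rewrite a0 eqxx /= in nzab.
have Z0 : Z = 0 by apply: (mulfI nzab); rewrite a0 in e2 e3; lra.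
have XY : X = Y by apply: (mulfI nzab); rewrite a0 in e1; lra.
have X0 : 0 < X by lra.
pose s := (Num.sqrt X)^-1.
have ssX : s * s * X = 1.
  have := sqr_sqrtr (ltW X0); have : 0 < Num.sqrt X by rewrite sqrtr_gt0.
  by rewrite /s; move: (Num.sqrt X) => t t0 <-; field; rewrite gt_eqF.
have mx1 (M : 'M[R]_1) c : M 0 0 = c -> M = c%:M.
  by move=> <-; exact: mx11_scalar.
(* x B = - b y, hence the sign of the new factor *)
exists (- b), (s *: x), (s *: y); split; rewrite ?oppr_eq0 //.
- by apply: mx1; rewrite linearZ /= -scalemxAl -scalemxAr scalerA mxE.
- by apply: mx1; rewrite linearZ /= -scalemxAl -scalemxAr scalerA mxE -/Y -XY.
- rewrite linearZ /= -scalemxAl -scalemxAr scalerA.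
  by rewrite [x *m _]mx11_scalar xy_yx -/Z Z0 -scalemx1 !scale0r scaler0.
- rewrite -!scalemxAl xB yB a0 !scale0r add0r addr0 opprK !scaleNr scalerN.
  by rewrite !scalerA (mulrC s).
Qed.

Lemma mul_diag_eq0 k m (M : 'M[R]_(k, m)) (d : 'rV[R]_m) :
  (forall i, d 0 i != 0) -> M *m diag_mx d = 0 -> M = 0.
Proof.
move=> nzd; rewrite mul_mx_diag => /matrixP Md0; apply/matrixP => i j.
have /eqP := Md0 i j; rewrite !mxE mulf_eq0 (negbTE (nzd j)) orbF.
by move/eqP.
Qed.

(** With the rows f_s of [F] and g_s of [G], this is the decomposition
    B = sum_s d_s (f_s^T g_s - g_s^T f_s), the matrix form of
    E = sum_s d_s f_s /\ g_s. *)
Definition skew_normal_form_of B m (d : 'rV[R]_m) (F G : 'M[R]_(m, n)) : Prop :=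
  [/\ F *m F^T = 1%:M, G *m G^T = 1%:M, F *m G^T = 0
    & B = F^T *m diag_mx d *m G - G^T *m diag_mx d *m F].

Lemma skew_normal_form_mul B m (d : 'rV[R]_m) (F G : 'M[R]_(m, n)) :
  skew_normal_form_of B d F G ->
  B *m G^T = F^T *m diag_mx d /\ B *m F^T = - (G^T *m diag_mx d).
Proof.
move=> [FF GG FG ->]; have GF : G *m F^T = 0.
  by rewrite -[G]trmxK -trmx_mul FG trmx0.
rewrite !mulmxBl -!mulmxA FF GG FG GF !mulmx0 !mulmx1 subr0 sub0r.
by [].
Qed.

(** Induction on the rank: subtracting from [B] its part in an invariant plane
    leaves a skew matrix that kills this plane.  The rows of the normal form of
    the remainder lie in its row space, hence are orthogonal to the plane. *)
Lemma skew_normal_form B : B^T = - B ->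
  exists m (d : 'rV[R]_m) (F G : 'M[R]_(m, n)),
    (forall i, d 0 i != 0) /\ skew_normal_form_of B d F G.
Proof.
elim: {B}(\rank B).+1 {-2}B (ltnSn (\rank B)) => // k IHk B rB skewB.
have [->|nzB] := eqVneq B 0.
  exists 0%N, 0, 0, 0; split=> [[]//|]; split; rewrite ?trmx0 ?mulmx0 ?subrr //;
  by apply/matrixP => -[].
have [b [x [y [nzb xx yy xy [xB yB]]]]] := skew_plane skewB nzB.
have yx : y *m x^T = 0 by rewrite -[y]trmxK -trmx_mul xy trmx0.
pose B' := B - b *: (x^T *m y - y^T *m x).
have skewB' : B'^T = - B'.
  rewrite /B' linearB /= linearZ /= linearB /= !trmx_mul !trmxK skewB.
  by rewrite -scalerN opprB [in RHS]opprD opprK.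
have xB' : x *m B' = 0.
  rewrite /B' mulmxBr xB -scalemxAr mulmxBr !mulmxA xx xy mul1mx mul0mx.
  by rewrite subr0 subrr.
have yB' : y *m B' = 0.
  rewrite /B' mulmxBr yB -scalemxAr mulmxBr !mulmxA yy yx mul1mx mul0mx.
  by rewrite sub0r scalerN scaleNr subrr.
have leyB : (y <= B)%MS.
  by rewrite -(eqmx_scale y nzb) -xB submxMl.
have lexB : (x <= B)%MS.
  have nzNb : - b != 0 by rewrite oppr_eq0.
  by rewrite -(eqmx_scale x nzNb) -yB submxMl.
have ltB' : (B' < B)%MS.
  rewrite /ltmx; apply/andP; split.
    rewrite addmx_sub // eqmx_opp scalemx_sub // addmx_sub ?eqmx_opp //;
    exact: mulmx_sub.
  apply/negP => leB; have /submxP[u yE] := submx_trans leyB leB.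
  have : y *m y^T = 0.
    by rewrite {1}yE -mulmxA -[B']trmxK skewB' -trmx_mul mulmxN yB' oppr0 trmx0 mulmx0.
  by rewrite yy => /matrixP/(_ 0 0)/eqP; rewrite !mxE oner_eq0.
have [|m [d [F [G [nzd nfB']]]]] := IHk B' _ skewB'.
  by rewrite (leq_trans (rank_ltmx ltB')).
have [B'G B'F] := skew_normal_form_mul nfB'.
case: nfB' => FF GG FG B'E.
have xF : x *m F^T = 0.
  by apply: (mul_diag_eq0 nzd); rewrite -mulmxA -B'G mulmxA xB' mul0mx.
have yF : y *m F^T = 0.
  by apply: (mul_diag_eq0 nzd); rewrite -mulmxA -B'G mulmxA yB' mul0mx.
have xG : x *m G^T = 0.
  apply: (mul_diag_eq0 nzd); rewrite -mulmxA -[_ *m diag_mx _]opprK -B'F.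
  by rewrite mulmxN mulmxA xB' mul0mx oppr0.
have yG : y *m G^T = 0.
  apply: (mul_diag_eq0 nzd); rewrite -mulmxA -[_ *m diag_mx _]opprK -B'F.
  by rewrite mulmxN mulmxA yB' mul0mx oppr0.
have tr0 m1 m2 (M : 'M[R]_(m1, n)) (N : 'M[R]_(m2, n)) :
    M *m N^T = 0 -> N *m M^T = 0.
  by move=> MN; rewrite -[N]trmxK -trmx_mul MN trmx0.
exists (1 + m)%N, (row_mx b%:M d), (col_mx x F), (col_mx y G); split.
  move=> i; rewrite mxE; case: split => j; last exact: nzd.
  by rewrite ord1 mxE eqxx.
split; rewrite ?tr_col_mx ?mul_col_row.
- by rewrite xx FF xF (tr0 _ _ _ _ xF) -scalar_mx_block.
- by rewrite yy GG yG (tr0 _ _ _ _ yG) -scalar_mx_block.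
- by rewrite xy FG xG (tr0 _ _ _ _ yF) block_mx0.
have -> : diag_mx (row_mx b%:M d) = block_mx b%:M 0 0 (diag_mx d) :> 'M_(1 + m).
  rewrite diag_mx_row; congr block_mx.
  by apply/matrixP => i j; rewrite !ord1 !mxE.
rewrite !mul_row_block !mulmx0 !addr0 !add0r !mul_row_col.
rewrite !mul_mx_scalar -!scalemxAl opprD addrACA -B'E -scalerBr /B'.
by rewrite addrC subrK.
Qed.

(** The 2m orthonormal rows lie in the row space of [B], because [B] maps them
    to each other up to nonzero factors. *)
Lemma skew_normal_form_rank B m (d : 'rV[R]_m) (F G : 'M[R]_(m, n)) :
  (forall i, d 0 i != 0) -> skew_normal_form_of B d F G -> (2 * m <= \rank B)%N.
Proof.
move=> nzd nfB; have [BG BF] := skew_normal_form_mul nfB.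
case: (nfB) => FF GG FG _.
have GF : G *m F^T = 0 by rewrite -[G]trmxK -trmx_mul FG trmx0.
have HH : col_mx F G *m (col_mx F G)^T = 1%:M.
  by rewrite tr_col_mx mul_col_row FF GG FG GF -scalar_mx_block.
have <- : \rank (col_mx F G) = (2 * m)%N.
  apply/eqP; rewrite mul2n -addnn; apply/row_freeP.
  by exists (col_mx F G)^T.
rewrite -(mxrank_tr B) mxrankS // col_mx_sub.
have dK : diag_mx d *m diag_mx (map_mx GRing.inv d) = 1%:M.
  rewrite mulmx_diag; apply/matrixP => i j; rewrite !mxE.
  by case: eqP => // _; rewrite mulfV ?nzd.
apply/andP; split.
  have -> : F = (B *m G^T *m diag_mx (map_mx GRing.inv d))^T.
    by rewrite BG -mulmxA dK mulmx1 trmxK.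
  by rewrite !trmx_mul mulmxA submxMl.
have -> : G = - (B *m F^T *m diag_mx (map_mx GRing.inv d))^T.
  by rewrite BF mulNmx -mulmxA dK mulmx1 linearN /= trmxK opprK.
by rewrite !trmx_mul eqmx_opp mulmxA submxMl.
Qed.

Lemma skew_normal_form_norm B m (d : 'rV[R]_m) (F G : 'M[R]_(m, n)) :
  skew_normal_form_of B d F G ->
  \sum_k \sum_l B k l ^+ 2 = 2 * \sum_s d 0 s ^+ 2.
Proof.
move=> [FF GG FG BE]; have GF : G *m F^T = 0.
  by rewrite -[G]trmxK -trmx_mul FG trmx0.
transitivity (\tr (B *m B^T)).
  rewrite /mxtrace; apply: eq_bigr => k _; rewrite mxE; apply: eq_bigr => l _.
  by rewrite mxE expr2.
have -> : B *m B^T = F^T *m diag_mx d *m diag_mx d *m F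
                   + G^T *m diag_mx d *m diag_mx d *m G.
  rewrite [in X in _ *m X]BE linearB /= !trmx_mul !trmxK !tr_diag_mx !mulmxA mulmxBr.
  rewrite !mulmxA; case: (skew_normal_form_mul (And4 FF GG FG BE)) => -> ->.
  by rewrite !mulNmx opprK.
rewrite linearD /= !(mxtrace_mulC _ F) !(mxtrace_mulC _ G) !mulmxA FF GG !mul1mx.
rewrite mulmx_diag mxtrace_diag mulr_natl mulr2n.
by congr (_ + _); apply: eq_bigr => s _; rewrite mxE expr2.
Qed.

End SkewNormalForm.

(** * The inner product and two inequalities *)

Section Dot.
Variables (R : realType) (X : finType).
Implicit Types u v w : {ffun X -> R^o}.

Lemma dotC u v : dot u v = dot v u.
Proof. by apply: eq_bigr => x _; rewrite mulrC. Qed.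

Lemma dotDl u v w : dot (u + v) w = dot u w + dot v w.
Proof. by rewrite -big_split; apply: eq_bigr => x _; rewrite ffunE mulrDl. Qed.

Lemma dotZl s u w : dot (s *: u) w = s * dot u w.
Proof. by rewrite mulr_sumr; apply: eq_bigr => x _; rewrite ffunE -mulrA. Qed.

Lemma dotNl u w : dot (- u) w = - dot u w.
Proof. by rewrite -scaleN1r dotZl mulN1r. Qed.

Lemma dotBl u v w : dot (u - v) w = dot u w - dot v w.
Proof. by rewrite dotDl dotNl. Qed.

Lemma dot0l w : dot 0 w = 0.
Proof. by rewrite -(scale0r 0) dotZl mul0r. Qed.

Lemma dot_suml (I : Type) (s : seq I) (P : pred I) (F : I -> {ffun X -> R^o}) w :
  dot (\sum_(i <- s | P i) F i) w = \sum_(i <- s | P i) dot (F i) w.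
Proof. by elim/big_rec2: _ => [|i y z _ <-]; rewrite ?dot0l // dotDl. Qed.

Lemma dotDr u v w : dot w (u + v) = dot w u + dot w v.
Proof. by rewrite !(dotC w) dotDl. Qed.

Lemma dotZr s u w : dot w (s *: u) = s * dot w u.
Proof. by rewrite !(dotC w) dotZl. Qed.

Lemma dotNr u w : dot w (- u) = - dot w u.
Proof. by rewrite !(dotC w) dotNl. Qed.

Lemma dotBr u v w : dot w (u - v) = dot w u - dot w v.
Proof. by rewrite !(dotC w) dotBl. Qed.

Lemma dot0r w : dot w 0 = 0.
Proof. by rewrite dotC dot0l. Qed.

Lemma dot_sumr (I : Type) (s : seq I) (P : pred I) (F : I -> {ffun X -> R^o}) w :
  dot w (\sum_(i <- s | P i) F i) = \sum_(i <- s | P i) dot w (F i).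
Proof. by rewrite dotC dot_suml; apply: eq_bigr => i _; rewrite dotC. Qed.

Lemma dot_ge0 u : 0 <= dot u u.
Proof. by apply: sumr_ge0 => x _; rewrite -expr2 sqr_ge0. Qed.

Lemma dot_eq0 u : (dot u u == 0) = (u == 0).
Proof.
apply/eqP/eqP => [uu|->]; last exact: dot0l.
have := psumr_eq0P (fun x _ => _ : 0 <= u x * u x) uu => u0.
apply/ffunP => x; rewrite ffunE; apply/eqP.
by rewrite -[_ == _]orbb -mulf_eq0 u0 // => y; rewrite -expr2 sqr_ge0.
Qed.

Lemma dot_sqrD_le u v : dot (u + v) (u + v) <= 2 * dot u u + 2 * dot v v.
Proof.
have := dot_ge0 (u - v).
rewrite !(dotDl, dotDr, dotBl, dotBr, dotNl, dotNr) (dotC v u); lra.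
Qed.

Lemma cauchy_schwarz_sum (I : finType) (f g : I -> R) :
  (\sum_i f i * g i) ^+ 2 <= (\sum_i f i ^+ 2) * (\sum_i g i ^+ 2).
Proof.
have : 0 <= \sum_i \sum_j (f i * g j - f j * g i) ^+ 2.
  by apply: sumr_ge0 => i _; apply: sumr_ge0 => j _; rewrite sqr_ge0.
have fgE (p q : I -> R) :
    (\sum_i p i) * (\sum_i q i) = \sum_i \sum_j p i * q j.
  by rewrite mulr_suml; apply: eq_bigr => i _; rewrite mulr_sumr.
have -> : \sum_i \sum_j (f i * g j - f j * g i) ^+ 2
    = 2 * ((\sum_i f i ^+ 2) * (\sum_i g i ^+ 2) - (\sum_i f i * g i) ^+ 2).
  have sym : \sum_i \sum_j f i ^+ 2 * g j ^+ 2 = \sum_i \sum_j f j ^+ 2 * g i ^+ 2.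
    exact: exchange_big.
  rewrite mulrBr [2 * _ in X in X - _]mulr_natl mulr2n expr2 !fgE {2}sym.
  rewrite -big_split mulr_sumr -sumrB; apply: eq_bigr => i _ /=.
  by rewrite -big_split mulr_sumr -sumrB; apply: eq_bigr => j _ /=; ring.
by rewrite pmulr_rge0 // subr_ge0.
Qed.

Lemma dot_combination_le (I : finType) (d : I -> R) (v : I -> {ffun X -> R^o}) :
  dot (\sum_i d i *: v i) (\sum_i d i *: v i)
  <= (\sum_i d i ^+ 2) * \sum_i dot (v i) (v i).
Proof.
have -> : (\sum_i d i ^+ 2) * \sum_i dot (v i) (v i)
    = \sum_x (\sum_i d i ^+ 2) * \sum_i v i x ^+ 2.
  by rewrite -mulr_sumr [in RHS]exchange_big; congr (_ * _).
apply: ler_sum => x _; rewrite sum_ffunE -expr2.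
under eq_bigr do rewrite ffunE; exact: cauchy_schwarz_sum.
Qed.

End Dot.

Lemma bessel_mx (R : realType) m n (H : 'M[R]_(m, n)) (y : 'cV[R]_n) :
  H *m H^T = 1%:M -> \sum_s ((H *m y) s 0) ^+ 2 <= \sum_k (y k 0) ^+ 2.
Proof.
move=> HH.
have sq k (z : 'cV[R]_k) : \sum_i (z i 0) ^+ 2 = (z^T *m z) 0 0.
  by rewrite mxE; apply: eq_bigr => i _; rewrite mxE expr2.
have : 0 <= \sum_k ((y - H^T *m (H *m y)) k 0) ^+ 2.
  by apply: sumr_ge0 => k _; rewrite sqr_ge0.
rewrite !sq; suff -> : (y - H^T *m (H *m y))^T *m (y - H^T *m (H *m y)) =
    y^T *m y - (H *m y)^T *m (H *m y) by rewrite !mxE subr_ge0.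
rewrite [(_ - _)^T]linearB /= !mulmxBr !mulmxBl !trmx_mul trmxK !mulmxA.
by rewrite -[y^T *m H^T *m H *m H^T]mulmxA HH mulmx1 subrr subr0.
Qed.

(** * Operators with canonical anticommutation relations *)

Section CAR.
Variables (R : realType) (n : nat) (X : finType).
Local Notation W := {ffun X -> R^o}.

(** The relations between the contractions [a k] with the vectors of an
    orthonormal frame and the exterior multiplications [c k] by the dual
    covectors.  They are abstracted from forms because double forms carry two
    such families, one for each tensor factor. *)
Definition car_family (a c : 'I_n -> {linear W -> W}) : Prop :=
  [/\ forall k u v, dot (a k u) v = dot u (c k v),
      forall k l u, a k (c l u) + c l (a k u) = (k == l)%:R *: u
    & forall k l u, a k (a l u) = - a l (a k u)].

Variables (a c : 'I_n -> {linear W -> W}).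
Hypothesis carE : car_family a c.
Implicit Types (u v : W) (f g : 'rV[R]_n) (B : 'M[R]_n).

(** The number operator sum_k c_k a_k multiplies a p-form by p. *)
Definition has_degree (p : nat) u : Prop := \sum_k c k (a k u) = p%:R *: u.

Definition ann f u : W := \sum_k f 0 k *: a k u.
Definition cre f u : W := \sum_k f 0 k *: c k u.

(** The derivation of the exterior algebra that extends the linear map of
    matrix [B] on covectors. *)
Definition one_body B u : W := \sum_k \sum_l B k l *: c l (a k u).

Let adjE k u v : dot (a k u) v = dot u (c k v). Proof. by case: carE. Qed.
Let adjE' k u v : dot (c k u) v = dot u (a k v).
Proof. by rewrite dotC -adjE dotC. Qed.
Let acE k l u : a k (c l u) = (k == l)%:R *: u - c l (a k u).
Proof. by case: carE => _ <- _; rewrite addrK. Qed.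
Let aaE k l u : a k (a l u) = - a l (a k u). Proof. by case: carE. Qed.

Lemma ann_annC f g u : ann f (ann g u) = - ann g (ann f u).
Proof.
transitivity (\sum_k \sum_l (f 0 k * g 0 l) *: a k (a l u)).
  apply: eq_bigr => k _; rewrite linear_sum /= scaler_sumr.
  by apply: eq_bigr => l _; rewrite [a k (_ *: _)]linearZ /= scalerA.
rewrite exchange_big -sumrN; apply: eq_bigr => l _ /=.
rewrite linear_sum /= scaler_sumr -sumrN; apply: eq_bigr => k _.
by rewrite [a l (_ *: _)]linearZ aaE /= scalerA scalerN mulrC.
Qed.

Let aa0 k u : a k (a k u) = 0.
Proof.
have /eqP := aaE k k u; rewrite -addr_eq0 -mulr2n -scaler_nat.
by rewrite scaler_eq0 pnatr_eq0 => /eqP.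
Qed.

Lemma ann_ann0 f u : ann f (ann f u) = 0.
Proof.
have /eqP := ann_annC f f u; rewrite -addr_eq0 -mulr2n -scaler_nat.
by rewrite scaler_eq0 pnatr_eq0 => /eqP.
Qed.

Lemma dot_ann f u v : dot (ann f u) v = dot u (cre f v).
Proof.
rewrite /ann /cre dot_suml dot_sumr; apply: eq_bigr => k _.
by rewrite dotZl dotZr adjE.
Qed.

Lemma ann_cre f g u :
  ann f (cre g u) = (f *m g^T) 0 0 *: u - cre g (ann f u).
Proof.
rewrite /ann /cre; under eq_bigr do rewrite linear_sum scaler_sumr.
under [X in _ - X]eq_bigr do rewrite linear_sum scaler_sumr.
rewrite [X in _ - X]exchange_big mxE scaler_suml -sumrB; apply: eq_bigr => k _ /=.
rewrite mxE -[X in X *: u - _]mulr1.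
transitivity (\sum_l (f 0 k * g 0 l) *: ((k == l)%:R *: u - c l (a k u))).
  by apply: eq_bigr => l _; rewrite [a k (_ *: _)]linearZ /= acE scalerA.
under [LHS]eq_bigr do rewrite scalerBr.
rewrite sumrB; congr (_ - _).
  rewrite (bigD1 k) //= eqxx scalerA big1 ?addr0 // => l /negbTE nlk.
  by rewrite eq_sym nlk scale0r scaler0.
by apply: eq_bigr => l _; rewrite [c l (_ *: _)]linearZ /= !scalerA mulrC.
Qed.

Lemma ann_cre_pythagoras f u : f *m f^T = 1%:M ->
  dot (cre f u) (cre f u) + dot (ann f u) (ann f u) = dot u u.
Proof.
move=> ff; rewrite -dot_ann ann_cre ff mxE scale1r.
by rewrite dotBl (dotC (cre _ _)) -dot_ann subrK.
Qed.

Lemma degree_norm p u : has_degree p u ->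
  \sum_k dot (a k u) (a k u) = p%:R * dot u u.
Proof.
by move=> degu; under eq_bigr do rewrite adjE; rewrite -dot_sumr degu dotZr.
Qed.

(** [v] is the image of [u] under the derivation attached to f /\ g.  Its two
    terms are orthogonal, since iota_f anticommutes with g /\ _ and squares to
    zero.  The first bound holds because multiplication by a unit covector does
    not increase norms; the second uses f /\ iota_g u = - iota_g (f /\ u) and
    |f /\ u|^2 + |iota_f u|^2 = |u|^2. *)
Lemma rotation_norm f g u : f *m f^T = 1%:M -> g *m g^T = 1%:M -> f *m g^T = 0 ->
  let v := cre g (ann f u) - cre f (ann g u) in
  dot v v <= dot (ann f u) (ann f u) + dot (ann g u) (ann g u)
  /\ dot v v <= dot u u.
Proof.
move=> ff gg fg v.
have orth : dot (cre g (ann f u)) (cre f (ann g u)) = 0.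
  rewrite -dot_ann ann_cre fg mxE scale0r sub0r ann_ann0.
  by rewrite /cre big1 ?oppr0 ?dot0l // => k _; rewrite linear0 scaler0.
have -> : dot v v = dot (cre g (ann f u)) (cre g (ann f u))
                  + dot (cre f (ann g u)) (cre f (ann g u)).
  by rewrite /v !(dotBl, dotBr) (dotC (cre f _)) orth; ring.
have lef w : dot (cre f w) (cre f w) <= dot w w.
  by have := ann_cre_pythagoras w ff; have := dot_ge0 (ann f w); lra.
have leg w : dot (cre g w) (cre g w) <= dot w w.
  by have := ann_cre_pythagoras w gg; have := dot_ge0 (ann g w); lra.
have lega w : dot (ann g w) (ann g w) <= dot w w.
  by have := ann_cre_pythagoras w gg; have := dot_ge0 (cre g w); lra.
split; first by rewrite lerD.
have gf : g *m f^T = 0 by rewrite -[g]trmxK -trmx_mul fg trmx0.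
have -> : cre f (ann g u) = - ann g (cre f u).
  by rewrite ann_cre gf mxE scale0r sub0r opprK.
rewrite dotNl dotNr opprK -(ann_cre_pythagoras u ff) addrC.
by rewrite lerD.
Qed.

Lemma bessel_ann m (H : 'M[R]_(m, n)) u : H *m H^T = 1%:M ->
  \sum_s dot (ann (row s H) u) (ann (row s H) u) <= \sum_k dot (a k u) (a k u).
Proof.
move=> HH; rewrite exchange_big [leRHS]exchange_big; apply: ler_sum => x _ /=.
pose y : 'cV[R]_n := \col_k a k u x.
have := bessel_mx y HH; under [leRHS]eq_bigr do rewrite mxE expr2.
apply: le_trans; rewrite le_eqVlt; apply/orP; left; apply/eqP.
apply: eq_bigr => s _; rewrite expr2; suff -> : ann (row s H) u x = (H *m y) s 0 by [].
by rewrite sum_ffunE mxE; apply: eq_bigr => k _; rewrite ffunE !mxE.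
Qed.

Lemma one_body_normal_form B m (d : 'rV[R]_m) (F G : 'M[R]_(m, n)) u :
  skew_normal_form_of B d F G ->
  one_body B u = \sum_s d 0 s *:
    (cre (row s G) (ann (row s F) u) - cre (row s F) (ann (row s G) u)).
Proof.
have creann f g v : cre g (ann f v) = \sum_k \sum_l (f 0 k * g 0 l) *: c l (a k v).
  rewrite /cre /ann exchange_big; apply: eq_bigr => l _ /=.
  rewrite linear_sum scaler_sumr; apply: eq_bigr => k _ /=.
  by rewrite [c l (_ *: _)]linearZ /= scalerA mulrC.
case=> _ _ _ ->; under [RHS]eq_bigr do rewrite !creann -sumrB scaler_sumr.
rewrite [RHS]exchange_big; apply: eq_bigr => k _ /=.
under [RHS]eq_bigr do rewrite -sumrB scaler_sumr.
rewrite [RHS]exchange_big; apply: eq_bigr => l _ /=.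
under [RHS]eq_bigr do rewrite -scalerBl scalerA.
rewrite -scaler_suml; congr (_ *: _).
rewrite !mul_mx_diag !mxE -sumrB; apply: eq_bigr => s _.
by rewrite !mxE; ring.
Qed.

(** In the normal form of [B], Cauchy-Schwarz separates the coefficients d_s from
    the images v_s of [u] under the elementary rotations, and the two bounds of
    [rotation_norm] on |v_s|^2 are summed over s: the first by Bessel, the
    second over the at most r rotations.  The factor 2 on the left is there
    because the squared entries of [B] add up to 2 sum_s d_s^2. *)
Lemma one_body_bound B p r u : B^T = - B -> (\rank B <= 2 * r)%N ->
  has_degree p u ->
  2 * dot (one_body B u) (one_body B u)
  <= (minn p r)%:R * (\sum_k \sum_l B k l ^+ 2) * dot u u.
Proof.
move=> skewB rB degu.
have [m [d [F [G [nzd nfB]]]]] := skew_normal_form skewB.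
have := skew_normal_form_rank nzd nfB => m_le.
rewrite (one_body_normal_form u nfB) (skew_normal_form_norm nfB).
rewrite mulrCA -!mulrA ler_pM2l // mulrCA.
pose v s := cre (row s G) (ann (row s F) u) - cre (row s F) (ann (row s G) u).
apply: (le_trans (dot_combination_le (fun s => d 0 s) v)).
apply: ler_wpM2l; first by apply: sumr_ge0 => s _; rewrite sqr_ge0.
case: nfB => FF GG FG _.
have GF : G *m F^T = 0 by rewrite -[G]trmxK -trmx_mul FG trmx0.
have rowm (M N : 'M[R]_(m, n)) s t : row s M *m (row t N)^T = (M *m N^T) s t *: 1%:M.
  apply/matrixP => i j; rewrite !ord1 mxE [RHS]mxE mxE !mxE eqxx mulr1.
  by apply: eq_bigr => k _; rewrite !mxE.
have rot s := @rotation_norm (row s F) (row s G) u.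
have {}rot s : dot (v s) (v s) <= dot (ann (row s F) u) (ann (row s F) u)
    + dot (ann (row s G) u) (ann (row s G) u) /\ dot (v s) (v s) <= dot u u.
  by apply: rot; rewrite rowm ?FF ?GG ?FG ?mxE ?eqxx ?scale1r ?scale0r.
have lep : \sum_s dot (v s) (v s) <= p%:R * dot u u.
  rewrite -(degree_norm degu).
  have HH : col_mx F G *m (col_mx F G)^T = 1%:M.
    by rewrite tr_col_mx mul_col_row FF GG FG GF -scalar_mx_block.
  apply: le_trans (bessel_ann u HH).
  rewrite big_split_ord /= -big_split /=; apply: ler_sum => s _.
  by rewrite rowKu rowKd; case: (rot s).
have ler : \sum_s dot (v s) (v s) <= r%:R * dot u u.
  apply: (@le_trans _ _ (m%:R * dot u u)); last first.
    by rewrite ler_wpM2r ?dot_ge0 // ler_nat; lia.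
  rewrite mulr_natl -[m in leRHS]card_ord -sumr_const; apply: ler_sum => s _.
  by case: (rot s).
by rewrite /minn; case: ifP.
Qed.

Lemma one_body_skew B u v : B^T = - B ->
  dot (one_body B u) v = - dot u (one_body B v).
Proof.
move=> /matrixP skewB; rewrite /one_body dot_suml dot_sumr.
under eq_bigr do rewrite dot_suml.
under [X in _ = - X]eq_bigr do rewrite dot_sumr.
rewrite [in LHS]exchange_big -sumrN; apply: eq_bigr => l _ /=.
rewrite -sumrN; apply: eq_bigr => k _; have := skewB l k; rewrite !mxE => ->.
by rewrite dotZl dotZr adjE' adjE mulNr.
Qed.

Lemma degree_ann p k u : has_degree p u ->
  \sum_l c l (a l (a k u)) = (p%:R - 1) *: a k u.
Proof.
move=> degu.
have -> : \sum_l c l (a l (a k u)) = \sum_l (a k (c l (a l u)) - (k == l)%:R *: a l u).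
  apply: eq_bigr => l _; rewrite acE addrAC subrr add0r (aaE k l).
  by rewrite linearN /= opprK.
rewrite sumrB -linear_sum degu linearZ /= scalerBl scale1r; congr (_ - _).
rewrite (bigD1 k) //= eqxx scale1r big1 ?addr0 // => l /negbTE nlk.
by rewrite eq_sym nlk scale0r.
Qed.

(** With T_kl = c_l a_k, the terms |T_kl|^2 add up to
    (n - (p - 1)) p |u|^2, since a_k lowers the degree to p - 1, and
    a_l a_l = 0 leaves only k = l in the sum of <T_kl, T_lk>, namely
    p |u|^2. *)
Lemma casimir_same p u : has_degree p u ->
  \sum_k \sum_l (dot (c l (a k u)) (c l (a k u)) - dot (c l (a k u)) (c k (a l u)))
  = p%:R * (n%:R - p%:R) * dot u u.
Proof.
move=> degu; under eq_bigr do rewrite sumrB.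
have e1 k : \sum_l dot (c l (a k u)) (c l (a k u))
    = (n%:R - (p%:R - 1)) * dot (a k u) (a k u).
  transitivity (\sum_l (dot (a k u) (a k u) - dot (a k u) (c l (a l (a k u))))).
    by apply: eq_bigr => l _; rewrite adjE' acE eqxx scale1r dotBr.
  rewrite sumrB sumr_const card_ord -dot_sumr (degree_ann _ degu) dotZr.
  by rewrite -mulr_natl; ring.
have e2 k : \sum_l dot (c l (a k u)) (c k (a l u)) = dot (a k u) (a k u).
  rewrite (bigD1 k) //= adjE' acE eqxx scale1r dotBr [X in _ - X](_ : _ = 0).
    rewrite subr0 big1 ?addr0 // => l /negbTE nlk.
    rewrite adjE' acE nlk scale0r sub0r.
    by rewrite aa0 linear0 oppr0 dot0r.
  by rewrite aa0 linear0 dot0r.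
under eq_bigr do rewrite e1 e2.
by rewrite sumrB -mulr_sumr (degree_norm degu); ring.
Qed.

End CAR.

Section TwoFamilies.
Variables (R : realType) (n : nat) (X : finType).
Local Notation W := {ffun X -> R^o}.
Variables (a c a' c' : 'I_n -> {linear W -> W}).
Hypotheses (car1 : car_family a c) (car2 : car_family a' c').
Hypotheses (aa' : forall k l u, a k (a' l u) = a' l (a k u))
           (ca' : forall k l u, a' k (c l u) = c l (a' k u)).

(** Passing to adjoints, the second sum becomes
    |sum_k a_k a'_k u|^2, and the anticommutation of a_l with c_k turns the
    first one into p |u|^2 - |sum_k c_k a'_k u|^2.  On double forms these are
    the norms of the contraction and of the first Bianchi sum. *)
Lemma casimir_cross p u : has_degree a' c' p u ->
  \sum_k a k (a' k u) = 0 -> \sum_k c k (a' k u) = 0 ->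
  \sum_k \sum_l (dot (c l (a k u)) (c' l (a' k u))
               - dot (c l (a k u)) (c' k (a' l u))) = p%:R * dot u u.
Proof.
move=> degu tr0 bianchi0.
have adj1 k v w : dot (c k v) w = dot v (a k w).
  by case: car1 => adj _ _; rewrite dotC -adj dotC.
have adj2 k v w : dot v (c' k w) = dot (a' k v) w by case: car2.
under eq_bigr do under eq_bigr do rewrite !adj2 !ca' !adj1.
under eq_bigr do rewrite sumrB.
rewrite sumrB [X in _ - X](_ : _ = 0) ?subr0; last first.
  under eq_bigr do rewrite -dot_sumr.
  by rewrite tr0 big1 // => k _; rewrite dot0r.
have := congr1 (fun v => dot v (\sum_l c l (a' l u))) bianchi0.
rewrite dot0l dot_suml; under eq_bigr do rewrite dot_sumr.
have acE k l w : a k (c l w) = (k == l)%:R *: w - c l (a k w).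
  by case: car1 => _ <- _; rewrite addrK.
have -> : \sum_k \sum_l dot (c k (a' k u)) (c l (a' l u))
   = \sum_k (dot (a' k u) (a' k u) - \sum_l dot (a' l (a k u)) (a l (a' k u))).
  rewrite exchange_big; apply: eq_bigr => k _ /=.
  rewrite [X in X - _](_ : _ = \sum_l dot ((k == l)%:R *: a' k u) (a' l u)).
    rewrite -sumrB; apply: eq_bigr => l _.
    rewrite adj1 acE dotBr dotZr dotZl; congr (_ - _).
      by rewrite eq_sym dotC; case: eqP => [->|]; rewrite ?mul0r.
    by rewrite dotC adj1 dotC aa'.
  rewrite (bigD1 k) //= eqxx scale1r big1 ?addr0 // => l /negbTE nlk.
  by rewrite eq_sym nlk scale0r dot0l.
rewrite sumrB (degree_norm car2 degu) => /eqP; rewrite subr_eq0 => /eqP.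
by move->.
Qed.

End TwoFamilies.

(** * Sums over the lowest eigenvalues *)

(** Sort the indices by [lambda] and let [t] be the m-th lowest value.  Writing
    lambda = (lambda - t) + t, the differences are nonpositive on the m lowest
    indices, where x <= S/m can be used, and nonnegative on the others.  If
    there are fewer than m indices, the bound on [x] forces x = 0. *)
Lemma sum_lowest_le (R : realType) (A : finType) (lambda x : A -> R) (m : nat) :
  (0 < m)%N -> (forall a, 0 <= x a) -> (forall a, m%:R * x a <= \sum_b x b) ->
  (\sum_a x a) * sum_lowest lambda m <= m%:R * \sum_a lambda a * x a.
Proof.
move=> m0 x_ge0 x_le; set S := \sum_a x a.
pose le_lambda := relpre lambda <=%R; pose s := sort le_lambda (enum A).
have sumE (F : A -> R) : \sum_a F a = \sum_(a <- s) F a.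
  by rewrite -big_enum; apply: perm_big; rewrite perm_sym perm_sort.
have -> : sum_lowest lambda m = \sum_(a <- take m s) lambda a.
  by rewrite /sum_lowest sort_map -map_take big_map.
have [m_le|m_gt] := leqP m (size s); last first.
  have S0 : S = 0.
    apply/eqP; rewrite eq_le sumr_ge0 // andbT -(pmulr_rle0 _ (_ : 0 < m%:R - (size s)%:R)).
      rewrite mulrBl subr_le0 {1}/S mulr_sumr (le_trans (ler_sum _ (fun a _ => x_le a))) //.
      by rewrite sumr_const size_sort -cardE mulr_natl.
    by rewrite subr_gt0 ltr_nat.
  have x0 a : x a = 0 by apply: (psumr_eq0P _ S0).
  by rewrite S0 mul0r big1 ?mulr0 // => a _; rewrite x0 mulr0.
have [T [z [D [sE sizeT]]]] : exists T z D, s = rcons T z ++ D /\ size T = m.-1.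
  have := cat_take_drop m s; have := size_takel m_le.
  case/lastP: (take m s) => [|T z]; first by move=> /= m1; rewrite -m1 in m0.
  by rewrite size_rcons => sizeT sE; exists T, z, (drop m s); rewrite sE -sizeT.
have : pairwise le_lambda s.
  rewrite -sorted_pairwise; last by move=> a b c; exact: le_trans.
  by apply: sort_sorted => a b; exact: le_total.
rewrite {1}sE pairwise_cat pairwise_rcons.
case/and3P => /allrelP leTD /andP[/allP leT _] _.
have leD a : a \in D -> lambda z <= lambda a.
  by move=> aD; apply: leTD => //; rewrite mem_rcons mem_head.
have takeE : take m s = rcons T z.
  by rewrite sE take_size_cat // size_rcons sizeT prednK.
pose t := lambda z.
have /(congr1 ( *%R m%:R)) : \sum_a lambda a * x a
    = \sum_(a <- rcons T z) (lambda a - t) * x a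
      + \sum_(a <- D) (lambda a - t) * x a + t * S.
  rewrite -big_cat -sE -sumE /S mulr_sumr -big_split.
  by apply: eq_bigr => a _ /=; ring.
rewrite takeE => ->.
have lowT : (\sum_(a <- rcons T z) (lambda a - t)) * S
    <= m%:R * \sum_(a <- rcons T z) (lambda a - t) * x a.
  rewrite mulr_suml mulr_sumr big_seq [leRHS]big_seq; apply: ler_sum => a aT.
  rewrite mulrCA ler_wnM2l // subr_le0 /t.
  by move: aT; rewrite mem_rcons inE => /predU1P[->|/leT].
have lowD : 0 <= m%:R * \sum_(a <- D) (lambda a - t) * x a.
  rewrite mulr_ge0 // big_seq; apply: sumr_ge0 => a /leD aD.
  by rewrite mulr_ge0 // subr_ge0.
have : \sum_(a <- rcons T z) (lambda a - t)
     = \sum_(a <- rcons T z) lambda a - m%:R * t.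
  rewrite sumrB big_const_seq count_predT size_rcons sizeT prednK // iter_addr_0.
  by rewrite mulr_natl.
move=> sumT; rewrite sumT in lowT; lra.
Qed.

(** * Contractions and exterior multiplications on forms *)

Section Exterior.
Variables (R : realType) (n : nat).
Implicit Types (I J K : {set 'I_n}) (i j k l : 'I_n).
Implicit Types (theta eta E : extform R n).

Let sgn k I : R := (-1) ^+ inversions [set k] I.

Lemma inversions_set1 k I : inversions [set k] I = (\sum_(j in I) (j < k))%N.
Proof.
transitivity (\sum_(j in I | (j < k)%N) 1)%N; last first.
  by rewrite big_mkcondr; apply: eq_bigr => j _; case: ltnP.
rewrite /inversions cardsE -sum1_card.
rewrite (reindex_onto (fun j => (k, j)) snd) /=; last first.
  by case=> i j; rewrite unfold_in /= inE => /and3P[/eqP-> _ _].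
by apply: eq_bigl => j; rewrite unfold_in /= inE !eqxx andbT.
Qed.

Lemma sgnK k I : sgn k I * sgn k I = 1.
Proof. by rewrite /sgn -expr2 sqrr_sign. Qed.

Lemma sgnU k l I : k \notin I -> sgn l (k |: I) = (-1) ^+ (k < l)%N * sgn l I.
Proof. by move=> kI; rewrite /sgn !inversions_set1 big_setU1 //= exprD. Qed.

Lemma sgnD k l I : k \in I -> sgn l (I :\ k) = (-1) ^+ (k < l)%N * sgn l I.
Proof.
move=> kI; have := @sgnU k l (I :\ k); rewrite setD1K // !inE eqxx => -> //.
by rewrite mulrA -expr2 sqrr_sign mul1r.
Qed.

Lemma iotaE k theta I :
  iota_form k theta I = if k \in I then 0 else sgn k I * theta (k |: I).
Proof. by rewrite ffunE. Qed.

Lemma wedge1E k theta K : wedge (ext_basis R [set k]) theta K =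
  if k \in K then sgn k (K :\ k) * theta (K :\ k) else 0.
Proof.
rewrite ffunE; case: ifP => kK.
  rewrite (bigD1 [set k]) ?sub1set //= ffunE eqxx mulr1 big1 ?addr0 //.
  by move=> I /andP[_ /negbTE nI]; rewrite ffunE nI mulr0 mul0r.
rewrite big1 // => I IK; rewrite ffunE; case: eqP => [Ik|]; last by rewrite mulr0 mul0r.
by rewrite Ik sub1set kK in IK.
Qed.

Lemma iota_is_linear k : linear (@iota_form R n k).
Proof.
move=> s u v; apply/ffunP => I; rewrite !(iotaE, ffunE) /GRing.scale /=.
by case: ifP => _; ring.
Qed.
HB.instance Definition _ k := GRing.isLinear.Build R (extform R n)
  (extform R n) _ (@iota_form R n k) (iota_is_linear k).

Lemma wedge_is_linear theta : linear (wedge theta).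
Proof.
move=> s u v; apply/ffunP => K; rewrite !ffunE /GRing.scale /= mulr_sumr -big_split.
by apply: eq_bigr => I _; rewrite !ffunE /GRing.scale /=; ring.
Qed.
HB.instance Definition _ theta := GRing.isLinear.Build R (extform R n)
  (extform R n) _ (wedge theta) (wedge_is_linear theta).

Lemma wedge_suml (X : finType) (c : X -> R) (F : X -> extform R n) eta :
  wedge (\sum_x c x *: F x) eta = \sum_x c x *: wedge (F x) eta.
Proof.
apply/ffunP => K; rewrite sum_ffunE !ffunE.
under [RHS]eq_bigr do rewrite ffunE /GRing.scale /= ffunE mulr_sumr.
rewrite exchange_big; apply: eq_bigr => I _ /=.
rewrite sum_ffunE mulr_sumr mulr_suml; apply: eq_bigr => x _.
by rewrite ffunE /GRing.scale /=; ring.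
Qed.

Definition ext_ann k : {linear extform R n -> extform R n} := @iota_form R n k.
Definition ext_cre k : {linear extform R n -> extform R n} :=
  wedge (ext_basis R [set k]).

(** For distinct k and l, removing or inserting both indices in either order
    gives the same multi-index; the signs are opposite since exactly one of the
    two orders moves the larger index past the smaller one. *)
Lemma ext_car : car_family ext_ann ext_cre.
Proof.
split=> [k u v | k l u | k l u].
- rewrite /dot [RHS](bigID (fun K => k \in K)) /= [X in _ + X]big1 ?addr0; last first.
    by move=> K kK; rewrite wedge1E (negbTE kK) mulr0.
  rewrite [RHS](reindex_onto (fun I => k |: I) (fun K => K :\ k)) /=; last first.
    by move=> K kK; rewrite setD1K.
  rewrite [LHS](bigID (fun I => k \in I)) /= [X in X + _]big1 ?add0r; last first.
    by move=> I kI; rewrite iotaE kI mul0r.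
  apply: eq_big => [I | I kI]; last first.
    by rewrite iotaE wedge1E (negbTE kI) setU11 setU1K //; ring.
  rewrite setU11 /=; apply/idP/eqP => [kI|<-]; first by rewrite setU1K.
  by rewrite !inE eqxx.
- apply/ffunP => I; rewrite [LHS]ffunE [RHS]ffunE /GRing.scale /=.
  rewrite !iotaE !wedge1E !iotaE !inE.
  have [->|nkl] := eqVneq k l.
    have [lI|lI] := boolP (l \in I).
      by rewrite /= add0r mul1r setD1K // mulrA sgnK mul1r.
    by rewrite /= addr0 setU1K // mulrA sgnK !mul1r.
  rewrite mul0r /=.
  have [lI|lI] := boolP (l \in I); have [kI|kI] := boolP (k \in I);
    rewrite ?mulr0 ?addr0 //=.
  have <- : (k |: I) :\ l = k |: I :\ l.
    by apply/setP => j; rewrite !inE; case: eqVneq => //= ->; rewrite eq_sym (negbTE nkl).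
  rewrite (sgnD _ (_ : l \in k |: I)) ?inE ?lI ?orbT // ltnn mul1r.
  rewrite (sgnD _ lI) (sgnU _ kI) (sgnD _ lI) ltnn mul1r.
  by case: ltngtP (nkl : val k != val l) => //= _ _; rewrite ?expr0 ?expr1; ring.
- apply/ffunP => I; rewrite [RHS]ffunE !iotaE !inE.
  have [->|nkl] := eqVneq k l; first by case: ifP; rewrite ?mulr0 oppr0.
  have [lI|lI] := boolP (l \in I); have [kI|kI] := boolP (k \in I);
    rewrite ?mulr0 ?oppr0 ?(eq_sym l) ?(negbTE nkl) ?lI ?kI ?mulr0 ?oppr0 //=.
  rewrite (sgnU _ kI) (sgnU _ lI) (setUCA [set l]).
  by case: ltngtP (nkl : val k != val l) => //= _ _; rewrite ?expr0 ?expr1; ring.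
Qed.

End Exterior.

(** * The skew matrix of a 2-form *)

Section FormMatrix.
Variables (R : realType) (n : nat).
Implicit Types (I J K : {set 'I_n}) (i j k l : 'I_n).
Implicit Types (theta eta E : extform R n).

Lemma ext_number theta I :
  (\sum_k ext_cre R k (ext_ann R k theta)) I = #|I|%:R * theta I.
Proof.
rewrite sum_ffunE -sum1_card natr_sum mulr_suml big_mkcond [RHS]big_mkcond /=.
apply: eq_bigr => k _; rewrite wedge1E iotaE !inE eqxx /=.
by case: ifP => // kI; rewrite setD1K // mulrA -expr2 sqrr_sign.
Qed.

Lemma form_degree p theta : is_form p theta ->
  has_degree (@ext_ann R n) (@ext_cre R n) p theta.
Proof.
move=> fth; apply/ffunP => I; rewrite ext_number ffunE /GRing.scale /=.
by have [->|/fth->] := eqVneq (theta I) 0; rewrite ?mulr0.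
Qed.

Lemma iota_form_degree p k theta :
  is_form p theta -> is_form p.-1 (iota_form k theta).
Proof.
move=> fth I; rewrite iotaE; case: ifPn => kI; first by rewrite eqxx.
rewrite mulf_eq0 negb_or => /andP[_ /fth].
by rewrite cardsU1 kI add1n => <-.
Qed.

Lemma ext_basisE theta : theta = \sum_I theta I *: ext_basis R I.
Proof.
apply/ffunP => K; rewrite sum_ffunE (bigD1 K) //= !ffunE eqxx /GRing.scale /= mulr1.
by rewrite big1 ?addr0 // => I /negbTE nI; rewrite !ffunE eq_sym nI /GRing.scale /= mulr0.
Qed.

Lemma dot_ext_basis I theta : dot (ext_basis R I) theta = theta I.
Proof.
rewrite /dot (bigD1 I) //= ffunE eqxx mul1r big1 ?addr0 // => K /negbTE nK.
by rewrite ffunE nK mul0r.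
Qed.

Lemma form1E theta : is_form 1 theta ->
  theta = \sum_l theta [set l] *: ext_basis R [set l].
Proof.
move=> fth; rewrite [LHS]ext_basisE.
rewrite (bigID (fun I => I \in [set [set l] | l : 'I_n])) /= [X in _ + X]big1 ?addr0.
  by rewrite big_imset //= => i j _ _ /set1_inj.
move=> I nI; have [->|/fth/eqP/cards1P[l Il]] := eqVneq (theta I) 0.
  by rewrite scale0r.
by rewrite Il imset_f in nI.
Qed.

Definition form_mx E : 'M[R]_n := \matrix_(k, l) iota_form k E [set l].

Lemma iota_set0 k theta : iota_form k theta set0 = theta [set k].
Proof.
rewrite iotaE inE setU0.
suff -> : inversions [set k] set0 = 0%N by rewrite mul1r.
by rewrite inversions_set1 big_set0.
Qed.

Lemma form_mxE E k l : form_mx E k l = iota_form l (iota_form k E) set0.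
Proof. by rewrite mxE iota_set0. Qed.

Lemma form_mx_skew E : (form_mx E)^T = - form_mx E.
Proof.
apply/matrixP => k l; rewrite mxE [RHS]mxE !form_mxE.
by have [_ _ aa] := ext_car R n; rewrite [iota_form k _](aa k l) ffunE.
Qed.

Lemma derivation_one_body E : is_form 2 E ->
  derivation E =1 one_body (@ext_ann R n) (@ext_cre R n) (form_mx E).
Proof.
move=> fE theta; apply: eq_bigr => k _.
rewrite {1}[iota_form k E](form1E (iota_form_degree fE)) wedge_suml.
by apply: eq_bigr => l _; rewrite mxE.
Qed.

(** Contracting theta /\ eta = sum_j theta_j c_j eta twice and evaluating at the
    empty multi-index leaves only the contributions of the anticommutators. *)
Lemma wedge_form_mx theta eta k l : is_form 1 theta ->
  form_mx (wedge theta eta) k l =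
  theta [set k] * eta [set l] - theta [set l] * eta [set k].
Proof.
move=> fth; have [_ ac _] := ext_car R n.
have acE i j v : iota_form i (ext_cre R j v)
    = (i == j)%:R *: v - ext_cre R j (iota_form i v).
  by rewrite -(ac i j v) addrK.
rewrite form_mxE {1}(form1E fth) wedge_suml !linear_sum sum_ffunE /=.
transitivity (\sum_j (theta [set j] * (k == j)%:R * eta [set l]
                      - theta [set j] * (l == j)%:R * eta [set k])).
  apply: eq_bigr => j _; rewrite ![in LHS]linearZ [LHS]ffunE /=.
  suff -> : iota_form l (iota_form k (ext_cre R j eta)) set0
      = (k == j)%:R * eta [set l] - (l == j)%:R * eta [set k].
    by rewrite /GRing.scale /=; ring.
  rewrite acE linearB linearZ /= acE.
  have ev (u v w : extform R n) x (c d : R) :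
      (c *: u - (d *: v - w)) x = c * u x - d * v x + w x.
    by rewrite !ffunE /GRing.scale /=; ring.
  rewrite ev !iota_set0 wedge1E inE; ring.
by rewrite sumrB (bigD1 k) //= [in X in _ - X](bigD1 l) //= !eqxx !mulr1
     !big1 ?addr0 // => j /negbTE nj; rewrite eq_sym nj mulr0 mul0r.
Qed.

Lemma form_mx_is_linear : linear form_mx.
Proof. by move=> s u v; apply/matrixP => k l; rewrite !mxE linearP !ffunE. Qed.
HB.instance Definition _ := GRing.isLinear.Build R (extform R n) 'M[R]_n _
  form_mx form_mx_is_linear.

Lemma form_mx_rank E m : expressible_with E m -> (\rank (form_mx E) <= m)%N.
Proof.
move=> [theta [s [fth ->]]].
pose T : 'M[R]_(m, n) := \matrix_(i, k) theta i [set k].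
apply: leq_trans (rank_leq_row T); apply: mxrankS.
rewrite linear_sum; apply: summx_sub => i _ /=; rewrite linear_sum.
apply: summx_sub => j _ /=; rewrite linearZ /= scalemx_sub //.
have -> : form_mx (wedge (theta i) (theta j))
    = (row i T)^T *m row j T - (row j T)^T *m row i T.
  apply/matrixP => k l; rewrite wedge_form_mx // !mxE !big_ord1 !mxE.
  by congr (_ - _); rewrite mulrC.
by rewrite addmx_sub ?eqmx_opp // (submx_trans (submxMl _ _)) ?row_sub.
Qed.

Lemma form1_norm theta : is_form 1 theta ->
  dot theta theta = \sum_l theta [set l] ^+ 2.
Proof.
move=> fth; rewrite {1}(form1E fth) dot_suml; apply: eq_bigr => l _.
by rewrite dotZl dot_ext_basis expr2.
Qed.

(** The row k of the matrix is the 1-form iota_(e_k) E, and the squared norms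
    of these contractions add up to the degree of [E] times |E|^2. *)
Lemma form_mx_norm E : is_form 2 E ->
  \sum_k \sum_l form_mx E k l ^+ 2 = 2 * dot E E.
Proof.
move=> fE; rewrite -(degree_norm (ext_car R n) (form_degree fE)).
apply: eq_bigr => k _; rewrite [RHS]form1_norm; last exact: iota_form_degree fE.
by apply: eq_bigr => l _; rewrite mxE.
Qed.

Lemma form_mx_dot E k l :
  form_mx E k l = dot (wedge (ext_basis R [set k]) (ext_basis R [set l])) E.
Proof.
have [adj _ _] := ext_car R n.
by rewrite dotC -(adj k) dotC dot_ext_basis mxE.
Qed.

Lemma wedge_basis_form2 k l :
  is_form 2 (wedge (ext_basis R [set k]) (ext_basis R [set l])).
Proof.
move=> I; rewrite wedge1E; case: ifP => kI; last by rewrite eqxx.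
rewrite ffunE mulf_eq0 negb_or => /andP[_]; case: (I :\ k =P [set l]) => [Il _|].
  by rewrite (cardsD1 k) kI Il cards1.
by rewrite eqxx.
Qed.

(** Parseval: the entries of the matrix of [E] are its inner products with the
    2-forms e^k /\ e^l, and the right-hand side is the inner product of
    e^k /\ e^l with e^k' /\ e^l'. *)
Lemma orthonormal_form_mx (A : finType) (E : A -> extform R n) k l k' l' :
  orthonormal_basis2 E ->
  \sum_a form_mx (E a) k l * form_mx (E a) k' l'
  = (k == k')%:R * (l == l')%:R - (k == l')%:R * (l == k')%:R.
Proof.
move=> [fE orthE spanE].
set b := wedge (ext_basis R [set k']) (ext_basis R [set l']).
have [c bE] : exists c, b = \sum_a c a *: E a by apply/spanE/wedge_basis_form2.
have cE a : c a = form_mx (E a) k' l'.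
  rewrite form_mx_dot -/b bE dot_suml (bigD1 a) //= dotZl orthE eqxx mulr1.
  by rewrite big1 ?addr0 // => d /negbTE nd; rewrite dotZl orthE nd mulr0.
have set1_eq (i j : 'I_n) : ([set i] == [set j]) = (i == j).
  by apply/eqP/eqP => [/set1_inj|->].
transitivity (form_mx b k l).
  rewrite bE linear_sum summxE; apply: eq_bigr => a _.
  by rewrite linearZ /= [RHS]mxE cE mulrC.
rewrite wedge_form_mx; last first.
  by move=> I; rewrite ffunE; case: (I =P [set k']) => [->|]; rewrite ?cards1 ?eqxx.
by rewrite !ffunE !set1_eq; ring.
Qed.

End FormMatrix.

(** * Double forms and their two families of operators *)

Section DoubleForms.
Variables (R : realType) (n : nat).
Implicit Types (I J K : {set 'I_n}) (i j k l : 'I_n).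
Implicit Types (theta eta E : extform R n) (omega : dblform R n).
Local Notation form_op := {linear extform R n -> extform R n}.

Definition first_factor J omega : extform R n := [ffun I => omega (I, J)].
Definition second_factor I omega : extform R n := [ffun J => omega (I, J)].

Definition lift1 (f : extform R n -> extform R n) omega : dblform R n :=
  [ffun IJ => f (first_factor IJ.2 omega) IJ.1].
Definition lift2 (f : extform R n -> extform R n) omega : dblform R n :=
  [ffun IJ => f (second_factor IJ.1 omega) IJ.2].

Lemma first_factor_lift1 f omega J :
  first_factor J (lift1 f omega) = f (first_factor J omega).
Proof. by apply/ffunP => I; rewrite !ffunE. Qed.

Lemma second_factor_lift2 f omega I :
  second_factor I (lift2 f omega) = f (second_factor I omega).
Proof. by apply/ffunP => J; rewrite !ffunE. Qed.

Lemma first_factor_is_linear J : linear (first_factor J).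
Proof. by move=> s u v; apply/ffunP => I; rewrite !ffunE. Qed.
Lemma second_factor_is_linear I : linear (second_factor I).
Proof. by move=> s u v; apply/ffunP => J; rewrite !ffunE. Qed.
HB.instance Definition _ J := GRing.isLinear.Build R (dblform R n)
  (extform R n) _ (first_factor J) (first_factor_is_linear J).
HB.instance Definition _ I := GRing.isLinear.Build R (dblform R n)
  (extform R n) _ (second_factor I) (second_factor_is_linear I).

Lemma lift1_is_linear (f : form_op) : linear (lift1 f).
Proof.
move=> s u v; apply/ffunP => -[I J]; rewrite !ffunE /=.
by rewrite !linearP !ffunE.
Qed.
Lemma lift2_is_linear (f : form_op) : linear (lift2 f).
Proof.
move=> s u v; apply/ffunP => -[I J]; rewrite !ffunE /=.
by rewrite !linearP !ffunE.
Qed.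
HB.instance Definition _ (f : form_op) := GRing.isLinear.Build R (dblform R n)
  (dblform R n) _ (lift1 f) (lift1_is_linear f).
HB.instance Definition _ (f : form_op) := GRing.isLinear.Build R (dblform R n)
  (dblform R n) _ (lift2 f) (lift2_is_linear f).

Lemma dot_first_factor omega omega' :
  dot omega omega' = \sum_J dot (first_factor J omega) (first_factor J omega').
Proof.
rewrite /dot exchange_big pair_bigA; apply: eq_bigr => -[I J] _.
by rewrite !ffunE.
Qed.

Lemma dot_second_factor omega omega' :
  dot omega omega' = \sum_I dot (second_factor I omega) (second_factor I omega').
Proof.
rewrite /dot pair_bigA; apply: eq_bigr => -[I J] _.
by rewrite !ffunE.
Qed.

Lemma first_factor_inj omega omega' :
  (forall J, first_factor J omega = first_factor J omega') -> omega = omega'.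
Proof.
by move=> eqw; apply/ffunP => -[I J]; have /ffunP/(_ I) := eqw J; rewrite !ffunE.
Qed.

Lemma second_factor_inj omega omega' :
  (forall I, second_factor I omega = second_factor I omega') -> omega = omega'.
Proof.
by move=> eqw; apply/ffunP => -[I J]; have /ffunP/(_ J) := eqw I; rewrite !ffunE.
Qed.

Definition ann1 k : {linear dblform R n -> dblform R n} := lift1 (ext_ann R k).
Definition cre1 k : {linear dblform R n -> dblform R n} := lift1 (ext_cre R k).
Definition ann2 k : {linear dblform R n -> dblform R n} := lift2 (ext_ann R k).
Definition cre2 k : {linear dblform R n -> dblform R n} := lift2 (ext_cre R k).

Lemma car_lift1 : car_family ann1 cre1.
Proof.
have [adj ac aa] := ext_car R n; split=> [k u v | k l u | k l u].
- rewrite !dot_first_factor; apply: eq_bigr => J _.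
  by rewrite !first_factor_lift1 adj.
- apply: first_factor_inj => J.
  by rewrite linearD linearZ /= !first_factor_lift1 ac.
- apply: first_factor_inj => J.
  by rewrite linearN /= !first_factor_lift1 aa.
Qed.

Lemma car_lift2 : car_family ann2 cre2.
Proof.
have [adj ac aa] := ext_car R n; split=> [k u v | k l u | k l u].
- rewrite !dot_second_factor; apply: eq_bigr => J _.
  by rewrite !second_factor_lift2 adj.
- apply: second_factor_inj => J.
  by rewrite linearD linearZ /= !second_factor_lift2 ac.
- apply: second_factor_inj => J.
  by rewrite linearN /= !second_factor_lift2 aa.
Qed.

Lemma form_opE (f : form_op) theta I :
  f theta I = \sum_K theta K * f (ext_basis R K) I.
Proof.
rewrite {1}(ext_basisE theta) linear_sum sum_ffunE; apply: eq_bigr => K _ /=.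
by rewrite linearZ ffunE.
Qed.

Lemma lift1_lift2E (f h : form_op) omega I J :
  lift1 f (lift2 h omega) (I, J) = \sum_K \sum_L
    omega (K, L) * (f (ext_basis R K) I * h (ext_basis R L) J).
Proof.
rewrite ffunE form_opE; apply: eq_bigr => K _ /=.
rewrite ffunE ffunE (form_opE h) mulr_suml; apply: eq_bigr => L _ /=.
by rewrite ffunE; ring.
Qed.

Lemma lift12C (f h : form_op) omega :
  lift1 f (lift2 h omega) = lift2 h (lift1 f omega).
Proof.
apply/ffunP => -[I J]; rewrite lift1_lift2E exchange_big.
rewrite [RHS]ffunE [RHS]form_opE; apply: eq_bigr => L _ /=.
rewrite ffunE ffunE (form_opE f) mulr_suml; apply: eq_bigr => K _ /=.
by rewrite ffunE; ring.
Qed.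

Lemma tens_ext_lift (f h : form_op) omega :
  tens_ext (fun theta1 theta2 => tens (f theta1) (h theta2)) omega
  = lift1 f (lift2 h omega).
Proof.
apply/ffunP => -[I J]; rewrite lift1_lift2E sum_ffunE; apply: eq_bigr => K _.
by rewrite sum_ffunE; apply: eq_bigr => L _; rewrite !ffunE.
Qed.

Lemma tens_extD (F G : extform R n -> extform R n -> dblform R n) omega :
  tens_ext (fun u v => F u v + G u v) omega = tens_ext F omega + tens_ext G omega.
Proof.
rewrite -big_split; apply: eq_bigr => I _; rewrite -big_split /=.
by apply: eq_bigr => J _; rewrite scalerDr.
Qed.

Lemma tens_ext_sum (X : finType)
    (F : X -> extform R n -> extform R n -> dblform R n) omega :
  tens_ext (fun u v => \sum_x F x u v) omega = \sum_x tens_ext (F x) omega.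
Proof.
rewrite [RHS]exchange_big; apply: eq_bigr => I _; rewrite [RHS]exchange_big /=.
by apply: eq_bigr => J _; rewrite scaler_sumr.
Qed.

Lemma derivation_is_linear E : linear (derivation E).
Proof.
move=> s u v; rewrite /derivation scaler_sumr -big_split; apply: eq_bigr => k _.
by rewrite !linearP.
Qed.
HB.instance Definition _ E := GRing.isLinear.Build R (extform R n)
  (extform R n) _ (derivation E) (derivation_is_linear E).

Lemma dbl_rho_one_body E omega : is_form 2 E ->
  dbl_rho E omega = one_body ann1 cre1 (form_mx E) omega
                  + one_body ann2 cre2 (form_mx E) omega.
Proof.
move=> fE; rewrite /dbl_rho tens_extD.
have id2 w : lift2 (idfun : form_op) w = w by apply/ffunP => -[I J]; rewrite !ffunE.
have id1 w : lift1 (idfun : form_op) w = w by apply/ffunP => -[I J]; rewrite !ffunE.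
congr (_ + _).
  rewrite (tens_ext_lift (derivation E) idfun) id2.
  apply: first_factor_inj => J; rewrite first_factor_lift1.
  rewrite [LHS](derivation_one_body fE) linear_sum; apply: eq_bigr => k _.
  rewrite linear_sum; apply: eq_bigr => l _.
  by rewrite linearZ /= !first_factor_lift1.
rewrite (tens_ext_lift idfun (derivation E)) id1.
apply: second_factor_inj => J; rewrite second_factor_lift2.
rewrite [LHS](derivation_one_body fE) linear_sum; apply: eq_bigr => k _.
rewrite linear_sum; apply: eq_bigr => l _.
by rewrite linearZ /= !second_factor_lift2.
Qed.

Lemma bianchi_sumE omega :
  bianchi_sum omega = \sum_k cre1 k (ann2 k omega).
Proof.
rewrite /bianchi_sum tens_ext_sum; apply: eq_bigr => k _.
exact: (tens_ext_lift (ext_cre R k) (ext_ann R k)).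
Qed.

Lemma dbl_mul_metric omega :
  dbl_mul (metric_form R n) omega = \sum_k cre1 k (cre2 k omega).
Proof.
have tens_ext_is_additive (F : extform R n -> extform R n -> dblform R n) :
    {morph tens_ext F : u v / u + v}.
  move=> u v; rewrite -big_split; apply: eq_bigr => I _; rewrite -big_split /=.
  by apply: eq_bigr => J _; rewrite ffunE scalerDl.
have tens_ext0 (F : extform R n -> extform R n -> dblform R n) : tens_ext F 0 = 0.
  by rewrite /tens_ext big1 // => I _; rewrite big1 // => J _; rewrite ffunE scale0r.
rewrite /dbl_mul /metric_form (big_morph _ (tens_ext_is_additive _) (tens_ext0 _)).
apply: eq_bigr => k _; rewrite tens_ext_basis.
exact: (tens_ext_lift (ext_cre R k) (ext_cre R k)).
Qed.

(** The two sides have the same inner products, by the adjointness of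
    [contraction] to the multiplication by the metric; applied to their
    difference, this shows that it has norm zero. *)
Lemma contractionE omega :
  contraction omega = \sum_k ann1 k (ann2 k omega).
Proof.
apply/eqP; rewrite -subr_eq0 -dot_eq0; set d := _ - _.
rewrite {1}/d dotBl dot_contraction dbl_mul_metric dot_sumr dot_suml -sumrB.
have [adj1 _ _] := car_lift1; have [adj2 _ _] := car_lift2.
apply/eqP/big1 => k _; rewrite adj1 adj2 [cre1 k _]lift12C.
by rewrite subrr.
Qed.

Lemma dblform_degree p q omega : is_dblform p q omega ->
  has_degree ann1 cre1 p omega /\
  has_degree ann2 cre2 q omega.
Proof.
move=> fom; split.
  apply: first_factor_inj => J; rewrite linear_sum linearZ /=.
  under eq_bigr do rewrite !first_factor_lift1.
  apply: form_degree => I; rewrite ffunE => /fom[] //.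
apply: second_factor_inj => I; rewrite linear_sum linearZ /=.
under eq_bigr do rewrite !second_factor_lift2.
by apply: form_degree => J; rewrite ffunE => /fom[].
Qed.

End DoubleForms.

(** * Positivity of the curvature term *)

Section Casimir.
Variables (R : realType) (n : nat) (A : finType) (E : A -> extform R n).
Hypothesis hE : orthonormal_basis2 E.
Variable X : finType.
Local Notation W := {ffun X -> R^o}.

(** By Parseval the sum over an orthonormal basis of 2-forms equals the one
    over the basis (e^k /\ e^l), k < l, whose images are T_kl - T_lk. *)
Lemma casimir_sum (T : 'I_n -> 'I_n -> W) :
  \sum_a dot (\sum_k \sum_l form_mx (E a) k l *: T k l)
             (\sum_k \sum_l form_mx (E a) k l *: T k l)
  = \sum_k \sum_l (dot (T k l) (T k l) - dot (T k l) (T l k)).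
Proof.
pose B a (i : 'I_n * 'I_n) := form_mx (E a) i.1 i.2; pose U i := T i.1 i.2.
transitivity (\sum_a \sum_i \sum_j B a i * B a j * dot (U i) (U j)).
  apply: eq_bigr => a _; rewrite [in LHS]pair_bigA dot_suml; apply: eq_bigr => i _.
  rewrite dot_sumr; apply: eq_bigr => j _.
  by rewrite dotZl dotZr mulrA.
rewrite exchange_big [RHS]pair_bigA; apply: eq_bigr => i _ /=.
rewrite exchange_big /=.
pose i' := (i.2, i.1).
transitivity (\sum_j ((j == i)%:R * dot (U i) (U j) - (j == i')%:R * dot (U i) (U j))).
  apply: eq_bigr => j _; rewrite -mulr_suml (orthonormal_form_mx _ _ _ _ hE) -mulrBl.
  case: i @i' j => [k l] /= [k' l']; rewrite !xpair_eqE /= -!mulnb !natrM.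
  by rewrite !(eq_sym k) !(eq_sym l) (mulrC (k' == l)%:R).
rewrite sumrB (bigD1 i) //= [X in _ - X](bigD1 i') //= !eqxx !mul1r.
by rewrite !big1 ?addr0 // => j /negbTE->; rewrite mul0r.
Qed.

End Casimir.

(** For m = 0 the hypothesis on the eigenvalues is empty, so the weights must
    vanish; otherwise [sum_lowest_le] applies. *)
Lemma weighted_sum_pos (R : realType) (A : finType) (lambda x : A -> R) m :
  (forall a, 0 <= x a) -> (forall a, m%:R * x a <= \sum_b x b) ->
  (m = 0%N -> \sum_a x a = 0) -> ((0 < m)%N -> 0 < \sum_a x a) ->
  (0 < sum_lowest lambda m -> 0 < \sum_a lambda a * x a) /\
  (0 <= sum_lowest lambda m -> 0 <= \sum_a lambda a * x a).
Proof.
move=> x_ge0 x_le S0 Spos; have [m0|m_gt0] := posnP m.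
  have x0 a : x a = 0 by apply: (psumr_eq0P _ (S0 m0)).
  rewrite m0 /sum_lowest take0 big_nil ltxx; split=> // _.
  by rewrite big1 // => a _; rewrite x0 mulr0.
have := sum_lowest_le lambda m_gt0 x_ge0 x_le; have := Spos m_gt0.
have mpos : 0 < m%:R :> R by rewrite ltr0n.
move=> S_gt0 le; split=> sl.
  by rewrite -(pmulr_rgt0 _ mpos) (lt_le_trans _ le) // mulr_gt0.
by rewrite -(pmulr_rge0 _ mpos) (le_trans _ le) // mulr_ge0 // ltW.
Qed.

Section Weitzenboeck.
Variables (R : realType) (n r : nat) (A : finType) (E : A -> extform R n).
Variable lambda : A -> R.
Hypothesis hE : orthonormal_basis2 E.
Hypothesis hr : (1 <= r)%N.
Hypothesis hrank : forall a, exists2 m, is_rank (E a) m & (m <= 2 * r)%N.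
Implicit Types omega : dblform R n.
Local Notation rho a omega := (dbl_rho (E a) omega).
Local Notation rho1 a omega :=
  (one_body (@ann1 R n) (@cre1 R n) (form_mx (E a)) omega).
Local Notation rho2 a omega :=
  (one_body (@ann2 R n) (@cre2 R n) (form_mx (E a)) omega).

Let rhoE a omega : rho a omega = rho1 a omega + rho2 a omega.
Proof. by apply: dbl_rho_one_body; case: hE. Qed.

Let car1 := car_lift1 R n.
Let car2 := car_lift2 R n.

Lemma dot_Ric_L omega :
  dot (Ric_L E lambda omega) omega
  = \sum_a lambda a * dot (rho a omega) (rho a omega).
Proof.
rewrite dotNl dot_suml -sumrN; apply: eq_bigr => a _; rewrite dotZl -mulrN.
have skew u v : dot (rho a u) v = - dot u (rho a v).
  rewrite !rhoE dotDl dotDr.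
  rewrite (one_body_skew car1 _ _ (form_mx_skew _)).
  by rewrite (one_body_skew car2 _ _ (form_mx_skew _)) opprD.
by rewrite skew opprK.
Qed.

Lemma rho_factor_bound (a c : 'I_n -> {linear dblform R n -> dblform R n})
    p b omega :
  car_family a c -> has_degree a c p omega ->
  dot (one_body a c (form_mx (E b)) omega) (one_body a c (form_mx (E b)) omega)
  <= (minn p r)%:R * dot omega omega.
Proof.
move=> carE degw; case: (hE) => fE orthE _.
have rk : (\rank (form_mx (E b)) <= 2 * r)%N.
  by have [m [expr_m _] le_m] := hrank b; rewrite (leq_trans _ le_m) ?form_mx_rank.
have := one_body_bound carE (form_mx_skew (E b)) rk degw.
by rewrite form_mx_norm // orthE eqxx mulr1; lra.
Qed.

Let dblform_le p q omega : is_dblform p q omega -> omega != 0 -> (p <= n)%N.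
Proof.
move=> fom nz; have [I /fom[<- _]] : exists I, omega (I.1, I.2) != 0.
  apply/existsP; apply: contraNT nz; rewrite negb_exists => /forallP om0.
  apply/eqP/ffunP => -[I J]; rewrite ffunE; apply/eqP.
  by have := om0 (I, J); rewrite negbK.
by rewrite -[n in leqRHS]card_ord max_card.
Qed.

(** A (p, 0) double form is killed by the contractions of its second factor,
    so only the first factor contributes.  The bound m = 0 occurs for p = n
    only, when the total p(n - p) |omega|^2 vanishes. *)
Lemma Ric_L_form p omega :
  (1 <= p)%N -> is_dblform p 0 omega -> omega != 0 ->
  let m := ((p * (n - p)) %/ minn p r)%N in
  (0 < sum_lowest lambda m -> 0 < dot (Ric_L E lambda omega) omega) /\
  (0 <= sum_lowest lambda m -> 0 <= dot (Ric_L E lambda omega) omega).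
Proof.
move=> p1 fom nz m; have [deg1 deg2] := dblform_degree fom.
have ple := dblform_le fom nz.
have w_gt0 : 0 < dot omega omega by rewrite lt_def dot_eq0 nz dot_ge0.
have ann2_0 k : ann2 R k omega = 0.
  apply/eqP; rewrite -dot_eq0; apply/eqP; move: k isT.
  apply: psumr_eq0P => [k _|]; first exact: dot_ge0.
  by rewrite (degree_norm car2 deg2) mul0r.
have rhoE1 a : rho a omega = rho1 a omega.
  rewrite rhoE [X in _ + X]big1 ?addr0 // => k _.
  by rewrite big1 // => l _; rewrite ann2_0 linear0 scaler0.
have total : \sum_a dot (rho a omega) (rho a omega)
    = (p * (n - p))%:R * dot omega omega.
  under eq_bigr do rewrite rhoE1.
  by rewrite (casimir_sum hE) (casimir_same car1 deg1) natrM natrB.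
rewrite dot_Ric_L; apply: weighted_sum_pos => [a|a|m0|m0].
- exact: dot_ge0.
- rewrite total rhoE1; have := rho_factor_bound a car1 deg1.
  move=> /(ler_wpM2l (ler0n R m)) /le_trans; apply.
  by rewrite mulrA ler_wpM2r ?dot_ge0 // -natrM ler_nat leq_divM.
- rewrite total; suff -> : (n - p = 0)%N by rewrite muln0 mul0r.
  have M0 : (0 < minn p r)%N by rewrite leq_min p1.
  by have := ltn_ceil (p * (n - p)) M0; rewrite -/m m0; nia.
- by rewrite total mulr_gt0 // ltr0n (leq_trans m0) // leq_div.
Qed.

(** The two factors of the tensor product contribute by [casimir_same], the two
    mixed terms by [casimir_cross]. *)
Lemma casimir_bianchi p omega :
  is_dblform p p omega -> trace_free omega -> first_bianchi omega ->
  \sum_a dot (rho a omega) (rho a omega)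
  = 2 * (p%:R * (n%:R - p%:R + 1)) * dot omega omega.
Proof.
move=> fom; rewrite /trace_free contractionE /first_bianchi bianchi_sumE => tr0 bi0.
have [deg1 deg2] := dblform_degree fom.
pose T1 k l := cre1 R l (ann1 R k omega); pose T2 k l := cre2 R l (ann2 R k omega).
have T1E k l : cre1 R l (ann1 R k omega) = T1 k l by [].
have T2E k l : cre2 R l (ann2 R k omega) = T2 k l by [].
have c1 := casimir_same car1 deg1; have c2 := casimir_same car2 deg2.
have c12 : \sum_k \sum_l (dot (T1 k l) (T2 k l) - dot (T1 k l) (T2 l k))
    = p%:R * dot omega omega.
  apply: (casimir_cross car1 car2 _ _ deg2 tr0 bi0) => k l u; first exact: lift12C.
  by rewrite -[LHS]lift12C.
have c21 : \sum_k \sum_l (dot (T2 k l) (T1 k l) - dot (T2 k l) (T1 l k))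
    = p%:R * dot omega omega.
  rewrite -c12; under eq_bigr do rewrite sumrB; under [RHS]eq_bigr do rewrite sumrB.
  rewrite !sumrB [X in _ - X]exchange_big; congr (_ - _).
    by apply: eq_bigr => k _; apply: eq_bigr => l _; rewrite dotC.
  by apply: eq_bigr => k _; apply: eq_bigr => l _; rewrite dotC.
transitivity (\sum_k \sum_l (dot (T1 k l + T2 k l) (T1 k l + T2 k l)
                           - dot (T1 k l + T2 k l) (T1 l k + T2 l k))).
  rewrite -(casimir_sum hE); apply: eq_bigr => a _.
  suff -> : rho a omega = \sum_k \sum_l form_mx (E a) k l *: (T1 k l + T2 k l) by [].
  rewrite rhoE -big_split; apply: eq_bigr => k _ /=; rewrite -big_split.
  by apply: eq_bigr => l _; rewrite scalerDr.
transitivity (p%:R * (n%:R - p%:R) * dot omega omega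
            + p%:R * (n%:R - p%:R) * dot omega omega
            + p%:R * dot omega omega + p%:R * dot omega omega); last by ring.
rewrite -{1}c1 -c2 -{1}c12 -c21 -!big_split; apply: eq_bigr => k _ /=.
rewrite -!big_split; apply: eq_bigr => l _ /=.
by rewrite !(dotDl, dotDr) !T1E !T2E; ring.
Qed.

(** Here p = n is excluded: every rho(E_a) vanishes on (n, n) double forms, so
    the total would be zero, whereas it is 2n |omega|^2.  Hence p < n, which makes m
    positive. *)
Lemma Ric_L_bianchi p omega :
  (1 <= p)%N -> is_dblform p p omega ->
  trace_free omega -> first_bianchi omega -> omega != 0 ->
  let m := ((p * (n - p + 1)) %/ (2 * minn p r))%N in
  (0 < sum_lowest lambda m -> 0 < dot (Ric_L E lambda omega) omega) /\
  (0 <= sum_lowest lambda m -> 0 <= dot (Ric_L E lambda omega) omega).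
Proof.
move=> p1 fom tr0 bi0 nz m; have [deg1 deg2] := dblform_degree fom.
have ple := dblform_le fom nz.
have w_gt0 : 0 < dot omega omega by rewrite lt_def dot_eq0 nz dot_ge0.
have total := casimir_bianchi fom tr0 bi0.
have natE : p%:R * (n%:R - p%:R + 1) = (p * (n - p + 1))%:R :> R.
  by rewrite natrM natrD natrB.
have rho_le a : dot (rho a omega) (rho a omega)
    <= 2 * dot (rho1 a omega) (rho1 a omega) + 2 * dot (rho2 a omega) (rho2 a omega).
  by rewrite rhoE dot_sqrD_le.
have total_le : \sum_a dot (rho a omega) (rho a omega)
    <= 4 * (p * (n - p))%:R * dot omega omega.
  apply: le_trans (ler_sum _ (fun a _ => rho_le a)) _.
  rewrite big_split -!mulr_sumr !(casimir_sum hE) /=.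
  rewrite (casimir_same car1 deg1) (casimir_same car2 deg2) natrM natrB //; lra.
have plt : (p < n)%N.
  rewrite ltn_neqAle ple andbT; apply/negP => /eqP pn.
  move: total_le; have np0 : (n - p = 0)%N by rewrite -pn subnn.
  rewrite total natE np0 muln0 add0n muln1 mulr0 mul0r leNgt.
  by rewrite !mulr_gt0 // ltr0n.
rewrite dot_Ric_L; apply: weighted_sum_pos => [a|a|m0|m0].
- exact: dot_ge0.
- rewrite total natE; have := rho_le a.
  have := rho_factor_bound a car1 deg1; have := rho_factor_bound a car2 deg2.
  move=> b2 b1 b; have {b b1 b2} : dot (rho a omega) (rho a omega)
      <= 2 * (2 * minn p r)%:R * dot omega omega by rewrite natrM; lra.
  move=> /(ler_wpM2l (ler0n R m)) /le_trans; apply.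
  rewrite mulrA ler_wpM2r ?dot_ge0 // mulrCA ler_pM2l // -natrM ler_nat.
  exact: leq_divM.
- have M0 : (0 < 2 * minn p r)%N by rewrite muln_gt0 leq_min p1.
  by exfalso; have := ltn_ceil (p * (n - p + 1)) M0; rewrite -/m m0; nia.
- by rewrite total natE !mulr_gt0 // ltr0n; nia.
Qed.

End Weitzenboeck.

Theorem proposition1p2 (R : realType) (n r : nat) (V : vectType R)
    (g : V -> V -> R) (e : 'I_n -> V) (Rm : V -> V -> V -> V -> R)
    (A : finType) (E : A -> extform R n) (lambda : A -> R)
    (hn : \dim {: V} = n)
    (hg : inner_product g)
    (he : orthonormal_frame g e)
    (hRm : curvature_tensor Rm)
    (hE : orthonormal_basis2 E)
    (hlambda : forall a, curvature_operator Rm e (E a) = lambda a *: E a)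
    (hr : (1 <= r)%N)
    (hrank : forall a, exists2 m, is_rank (E a) m & (m <= 2 * r)%N) :
  (forall (p : nat) (omega : dblform R n),
      (1 <= p)%N -> is_dblform p 0 omega -> omega != 0 ->
      let m := ((p * (n - p)) %/ minn p r)%N in
      (0 < sum_lowest lambda m -> 0 < dot (Ric_L E lambda omega) omega) /\
      (0 <= sum_lowest lambda m -> 0 <= dot (Ric_L E lambda omega) omega))
  /\
  (forall (p : nat) (omega : dblform R n),
      (1 <= p)%N -> is_dblform p p omega -> dbl_symmetric omega ->
      trace_free omega -> first_bianchi omega -> omega != 0 ->
      let m := ((p * (n - p + 1)) %/ (2 * minn p r))%N in
      (0 < sum_lowest lambda m -> 0 < dot (Ric_L E lambda omega) omega) /\
      (0 <= sum_lowest lambda m -> 0 <= dot (Ric_L E lambda omega) omega)).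
Proof.
split=> p omega p1 fom.
  exact: Ric_L_form.
by move=> _; exact: Ric_L_bianchi.
Qed.
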